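(* Let $\mathcal{I}$ be any one of $\mathcal{P}$, $\mathcal{P}_\infty$, $\mathcal{B}$. The isometry class $\{\mu\in\mathcal{I}: X_\mu$ has the Daugavet property$\}$ is $G_\delta$-complete in $\mathcal{I}$.
   Context: Coding: $V$ is the set of finitely supported rational sequences; $\mathcal{P}\subset\mathbb{R}^V$ the seminorms on $V$ with pointwise convergence topology; for $\mu\in\mathcal{P}$, $\bar\mu$ is its seminorm extension to $c_{00}$ and $X_\mu$ the completion of $c_{00}/\{\bar\mu=0\}$; $\mathcal{P}_\infty=\{\mu:\dim X_\mu=\infty\}$, $\mathcal{B}=\{\mu\in\mathcal{P}_\infty:\bar\mu$ a norm on $c_{00}\}$, subspace topologies. Daugavet property: for every $\varepsilon>0$, $x\in S_X$ and slice $S=\{y\in B_X:f(y)>1-\alpha\}$ ($f\in S_{X^*}$, $\alpha>0$) there is $y\in S$ with $\|x-y\|>2-\varepsilon$. A set $A$ in a Polish space $Z$ is $G_\delta$-complete if it is $G_\delta$ and every $G_\delta$ subset of every zero-dimensional Polish space is a continuous preimage of $A$. *)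

(* Defs.v *)
From HB Require Import structures.
From mathcomp Require Import all_boot all_order all_algebra.
From mathcomp Require Import all_classical all_reals all_analysis.
Set Implicit Arguments. Unset Strict Implicit. Unset Printing Implicit Defensive.
Import Order.TTheory GRing.Theory Num.Theory.
Import numFieldNormedType.Exports.
Local Open Scope classical_set_scope.
Local Open Scope ring_scope.

Definition finsupp {T : zmodType} (x : nat -> T) :=
  exists N : nat, forall n : nat, (N <= n)%N -> x n = 0.

Definition V := {x : nat -> rat | finsupp x}.

Section Defs.
Variable R : realType.

Definition c00 : set (nat -> R) := [set x | finsupp x].

Definition ratseq (v : V) : nat -> R := fun n => ratr (proj1_sig v n).

Definition seminorm_V (mu : V -> R) :=
  (forall u v w : V, proj1_sig w = (fun n => proj1_sig u n + proj1_sig v n) ->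
      mu w <= mu u + mu v) /\
  (forall (q : rat) (u w : V), proj1_sig w = (fun n => q * proj1_sig u n) ->
      mu w = ratr `|q| * mu u).

Definition seminorm_c00 (m : (nat -> R) -> R) :=
  (forall x y, c00 x -> c00 y -> m (fun n => x n + y n) <= m x + m y) /\
  (forall (a : R) x, c00 x -> m (fun n => a * x n) = `|a| * m x).

(* m is the seminorm extension \bar mu of mu to c00 (it is unique) *)
Definition mubar_of (mu : V -> R) (m : (nat -> R) -> R) :=
  seminorm_c00 m /\ forall v : V, m (ratseq v) = mu v.

(* (X, j) is a completion of (c00 / {m = 0}, m): j is linear on c00,
   isometric for m (so it factors through the quotient) with dense range in
   the Banach space X *)
Definition completion_of (m : (nat -> R) -> R)
    (X : completeNormedModType R) (j : (nat -> R) -> X) :=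
  (forall (a : R) x y, c00 x -> c00 y ->
      j (fun n => a * x n + y n) = a *: j x + j y) /\
  (forall x, c00 x -> `|j x| = m x) /\
  closure (j @` c00) = setT.

Definition daugavet (X : normedModType R) :=
  forall (eps : R) (x : X) (f : X -> R) (alpha : R),
    0 < eps -> `|x| = 1 ->
    (forall (a : R) (u v : X), f (a *: u + v) = a * f u + f v) ->
    continuous f ->
    sup [set `|f y| | y in [set y : X | `|y| <= 1]] = 1 ->
    0 < alpha ->
    exists y : X, `|y| <= 1 /\ 1 - alpha < f y /\ 2 - eps < `|x - y|.

Definition infdim (X : normedModType R) :=
  forall n : nat, exists x : 'I_n -> X,
    forall c : 'I_n -> R, \sum_(i < n) c i *: x i = 0 -> forall i, c i = 0.

(* properties of X_mu (for the completion X_mu, unique up to isometry) *)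
Definition Xmu_daugavet (mu : V -> R) :=
  forall m, mubar_of mu m ->
  forall (X : completeNormedModType R) (j : (nat -> R) -> X),
    completion_of m j -> daugavet X.

Definition Xmu_infdim (mu : V -> R) :=
  forall m, mubar_of mu m ->
  forall (X : completeNormedModType R) (j : (nat -> R) -> X),
    completion_of m j -> infdim X.

Definition Pset : set {ptws V -> R} := [set mu | seminorm_V mu].
Definition Pinf : set {ptws V -> R} := [set mu | Pset mu /\ Xmu_infdim mu].
Definition Bset : set {ptws V -> R} :=
  [set mu | Pinf mu /\
     forall m, mubar_of mu m -> forall x, c00 x -> m x = 0 -> x = (fun=> 0)].

Definition polish (Z : topologicalType) :=
  (exists D : set Z, countable D /\ closure D = setT) /\
  exists d : Z -> Z -> R,
    [/\ forall x y, d x y = 0 <-> x = y,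
        forall x y, d x y = d y x,
        forall x y z, d x z <= d x y + d y z,
        (forall U : set Z, open U <->
           forall x, U x -> exists e : R, 0 < e /\ [set y | d x y < e] `<=` U) &
        (forall u : nat -> Z,
           (forall e : R, 0 < e -> exists N : nat, forall n k : nat,
               (N <= n)%N -> (N <= k)%N -> d (u n) (u k) < e) ->
           exists l : Z, forall e : R, 0 < e -> exists N : nat, forall n : nat,
               (N <= n)%N -> d (u n) l < e)].

Definition zero_dim (Z : topologicalType) :=
  forall (x : Z) (U : set Z), open U -> U x ->
    exists C : set Z, [/\ open C, closed C, C x & C `<=` U].

Definition Gdelta {Z : topologicalType} (A : set Z) :=
  exists U : nat -> set Z, (forall n, open (U n)) /\ A = \bigcap_n U n.

Definition Gdelta_complete_in (I A : set {ptws V -> R}) :=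
  (exists U : nat -> set {ptws V -> R},
      (forall n, open (U n)) /\ A = I `&` \bigcap_n U n) /\
  forall (Z : topologicalType), polish Z -> zero_dim Z ->
  forall B : set Z, Gdelta B ->
    exists f : Z -> {ptws V -> R},
      [/\ continuous f, forall z, I (f z) & B = f @^-1` A].

End Defs.

(* Main.v *)
Require Import Defs.
From HB Require Import structures.
From mathcomp Require Import all_boot all_order all_algebra.
From mathcomp Require Import all_classical all_reals all_analysis.
From mathcomp Require Import ring lra.
Set Implicit Arguments. Unset Strict Implicit. Unset Printing Implicit Defensive.
Import Order.TTheory GRing.Theory Num.Theory.
Import numFieldNormedType.Exports.
Local Open Scope classical_set_scope.
Local Open Scope ring_scope.

(* G_delta part. X has the Daugavet property iff, for x <> 0, every y in the open
   unit ball is close to averages of points d of the unit ball with |x - d|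
   almost |x| + 1: a functional sees one of the d as well as it sees y, and
   conversely a y that is far from all these averages is separated from them by
   a functional (Hahn-Banach), one of whose slices contains no such d.
   Restricted to x, y, d in the countable set V, this is a countable
   intersection of open conditions on mu.

   Completeness part. For a strictly decreasing sequence r of positive numbers,
   let N_r be the L1 norm on the step functions on the Cantor set, for the
   measure giving mass r_L to the cell of level L around a fixed point o and
   halving the mass of every cell that does not contain o. In a basis of step
   functions which does not depend on r, N_r is a norm on c00, and N_r(v) depends
   continuously on r. The measure is atomless iff r_L -> 0, and then the space is
   Daugavet; otherwise o is an atom, which destroys the Daugavet property.
   Given open sets U_n of a metric space Z, take r_L(z) = 1 / (1 + S_L(z)) (up
   to a correction for strictness), where the continuous functions S_L increase
   with L to the number of n with z in U_0 n ... n U_n. *)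

(** * Hahn-Banach *)

Lemma ler_addeps (R : realType) (a b C : R) :
  (forall e, 0 < e -> a <= b + e * C) -> a <= b.
Proof.
move=> H; apply/ler_addgt0Pr => e e0.
have C1 : 0 < `|C| + 1 by rewrite ltr_wpDl.
apply: (le_trans (H (e / (`|C| + 1)) _)); first by rewrite divr_gt0.
rewrite lerD2l -mulrA ger_pMr // mulrC ler_pdivrMr // mul1r.
by rewrite (le_trans (ler_norm C)) // lerDl.
Qed.

Section HahnBanach.
Variables (R : realType) (E : lmodType R).
Implicit Types (p q : E -> R) (S : set (E * R)).

Definition sublinear q :=
  (forall x y, q (x + y) <= q x + q y) /\
  (forall a x, 0 <= a -> q (a *: x) = a * q x).

Definition linearf (f : E -> R) := forall a u v, f (a *: u + v) = a * f u + f v.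

(** A pair [(x, a)] in [S] encodes the constraint [a <= f x] on the functional [f] to be found. *)
Definition cone S :=
  [/\ S (0, 0),
      forall u v, S u -> S v -> S (u.1 + v.1, u.2 + v.2) &
      forall a u, 0 <= a -> S u -> S (a *: u.1, a * u.2)].

Lemma sublinear0 q : sublinear q -> q 0 = 0.
Proof. by move=> [_ h]; rewrite -(scale0r 0) h // mul0r. Qed.

Lemma sublinearN q x : sublinear q -> - q (- x) <= q x.
Proof.
move=> sq; have := sq.1 x (- x); rewrite subrr sublinear0 //; lra.
Qed.

Section ConePerturbation.
Variables (q : E -> R) (S : set (E * R)).
Hypotheses (sq : sublinear q) (cS : cone S) (Sq : forall u, S u -> u.2 <= q u.1).

(** The infimum [p] is the largest sublinear function below [q] with [p (- u.1) <= - u.2] on [S]. It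
    is finite because [q] itself satisfies the constraints, and sublinear because [S] is stable
    under sums and nonnegative scaling. *)
Let val x := [set q (x + u.1) - u.2 | u in S].
Let p x := inf (val x).

Let lb x : has_lbound (val x).
Proof.
exists (- q (- x)) => _ [u Su <-].
have := sq.1 (x + u.1) (- x); rewrite addrAC subrr add0r.
by have := Sq Su; lra.
Qed.

Let ne x : val x !=set0.
Proof. by exists (q (x + 0) - 0); exists (0, 0) => //; case: cS. Qed.

Let pP x u : S u -> p x <= q (x + u.1) - u.2.
Proof. by move=> Su; apply: ge_inf (lb x) _ _; exists u. Qed.

Let adh x e : 0 < e -> exists2 u, S u & q (x + u.1) - u.2 < p x + e.
Proof.
move=> e0; have [_ [u Su <-] ?] := inf_adherent e0 (conj (ne x) (lb x)).
by exists u.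
Qed.

Lemma cone_perturb : exists p', [/\ sublinear p', forall x, p' x <= q x &
   forall u, S u -> p' (- u.1) <= - u.2].
Proof.
have [S0 SD SZ] := cS.
have pq x : p x <= q x by have := pP x S0; rewrite /= addr0 subr0.
have pZ a x : 0 < a -> p (a *: x) <= a * p x.
  move=> a0; apply: (@ler_addeps _ _ _ a) => e e0.
  have [u Su ltu] := adh x e0.
  have /= := pP (a *: x) (SZ a u (ltW a0) Su).
  rewrite -scalerDr (sq.2 _ _ (ltW a0)).
  have := ltW ltu; rewrite -(ler_pM2l a0) mulrBr mulrDr; lra.
exists p; split => //.
- split=> [x y|a x].
    apply: (@ler_addeps _ _ _ 2) => e e0.
    have [u Su ltu] := adh x e0; have [v Sv ltv] := adh y e0.
    have /= := pP (x + y) (SD _ _ Su Sv).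
    have := sq.1 (x + u.1) (y + v.1); rewrite addrACA; lra.
  rewrite le_eqVlt => /predU1P[<-|a0].
    rewrite scale0r mul0r; apply/eqP; rewrite eq_le.
    rewrite (le_trans (pq 0)) ?(sublinear0 sq) //=.
    apply: (lb_le_inf (ne 0)) => _ [u Su <-]; rewrite add0r subr_ge0; exact: Sq.
  apply/eqP; rewrite eq_le (pZ _ _ a0) /=.
  have ai0 : 0 < a^-1 by rewrite invr_gt0.
  have := pZ _ (a *: x) ai0; rewrite scalerA mulVf ?gt_eqF // scale1r.
  by rewrite -(ler_pM2l a0) mulrA divff ?gt_eqF // mul1r.
- move=> u Su; have := pP (- u.1) Su; rewrite addNr sublinear0 //.
  by rewrite sub0r.
Qed.

End ConePerturbation.

(** The constraints carried by this ray force a functional dominated by [q] to take the value [q x]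
    at [x]. *)
Lemma ray_cone q x : sublinear q ->
  cone [set u | exists2 t, 0 <= t & u = (t *: x, t * q x)].
Proof.
move=> sq; split.
- by exists 0; rewrite // scale0r mul0r.
- move=> _ _ [s s0 ->] [t t0 ->]; exists (s + t); first exact: addr_ge0.
  by rewrite /= scalerDl mulrDl.
- move=> a _ a0 [t t0 ->]; exists (a * t); first exact: mulr_ge0.
  by rewrite /= scalerA mulrA.
Qed.

(* A minimal sublinear functional is odd, hence linear. *)
Lemma minimal_sublinear q : sublinear q ->
  (forall p, sublinear p -> (forall x, p x <= q x) -> p = q) -> linearf q.
Proof.
move=> sq qmin.
have odd x : q (- x) = - q x.
  have [|p [sp pq pS]] := @cone_perturb q _ sq (ray_cone x sq).
    by move=> _ [t t0 ->] /=; rewrite sq.2.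
  rewrite (qmin p sp pq) in pS.
  apply/eqP; rewrite eq_le; apply/andP; split.
    have := pS (x, q x); apply; exists 1; first exact: ler01.
    by rewrite scale1r mul1r.
  by rewrite lerNl sublinearN.
have add x y : q (x + y) = q x + q y.
  apply/eqP; rewrite eq_le sq.1 /=.
  by have := sq.1 (x + y) (- y); rewrite addrK odd; lra.
have scl a x : q (a *: x) = a * q x.
  have [a0|a0] := leP 0 a; first exact: sq.2.
  rewrite -[a *: x]opprK odd -scaleNr sq.2 ?oppr_ge0 ?(ltW a0) //.
  by rewrite mulNr opprK.
by move=> a u v; rewrite add scl.
Qed.

(** Zorn's lemma yields a minimal sublinear function below [q]. The infimum of a chain is finite, as
    every member is at least [- q (- x)] at [x]. *)
Theorem hahn_banach q : sublinear q ->
  exists2 f, linearf f & forall x, f x <= q x.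
Proof.
move=> sq.
pose T := {p : E -> R | sublinear p /\ forall x, p x <= q x}.
pose Rel (s t : T) := `[< forall x, sval t x <= sval s x >].
have low (t : T) x : - q (- x) <= sval t x.
  have [st tq] := svalP t.
  by apply: le_trans (sublinearN x st); rewrite lerN2.
have T0 : T by exists q; split.
have [|||A Atot|m mmax] := @Zorn T Rel.
- by move=> t; apply/asboolP.
- move=> r s t /asboolP rs /asboolP st; apply/asboolP => x.
  exact: le_trans (st x) (rs x).
- move=> s t /asboolP st /asboolP ts; case: s t st ts => [s hs] [t ht] /= st ts; apply: eq_exist; apply/funext => x.
  by apply/eqP; rewrite eq_le st ts.
- have [->|/set0P[t0 At0]] := eqVneq A set0; first by exists T0.
  pose g x := inf [set sval t x | t in A].
  have lb x : has_lbound [set sval t x | t in A].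
    by exists (- q (- x)) => _ [t _ <-].
  have ne x : [set sval t x | t in A] !=set0 by exists (sval t0 x); exists t0.
  have gle t x : A t -> g x <= sval t x by move=> At; apply: ge_inf => //; exists t.
  have adh x e : 0 < e -> exists2 t, A t & sval t x < g x + e.
    move=> e0; have [_ [t At <-] ?] := inf_adherent e0 (conj (ne x) (lb x)).
    by exists t.
  have gZ a x : 0 <= a -> g (a *: x) <= a * g x.
    move=> a0; apply: (@ler_addeps _ _ _ a) => e e0.
    have [t At ltt] := adh x _ e0.
    apply: (le_trans (gle t _ At)); rewrite (svalP t).1.2 //.
    by rewrite [e * a]mulrC -mulrDr (ler_wpM2l a0 (ltW ltt)).
  have sg : sublinear g.
    split=> [x y|a x].
      apply: (@ler_addeps _ _ _ 2) => e e0.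
      have [s As lts] := adh x _ e0; have [t At ltt] := adh y _ e0.
      (* Of two members of the chain nearly optimal at [x] and at [y], the smaller one is nearly
         optimal at both. *)
      have := Atot _ _ As At; case=> /asboolP h.
        have := gle t (x + y) At; have := (svalP t).1.1 x y; have := h x; lra.
      have := gle s (x + y) As; have := (svalP s).1.1 x y; have := h y; lra.
    rewrite le_eqVlt => /predU1P[<-|a0].
      rewrite scale0r mul0r /g.
      rewrite (_ : [set _ | _ in _] = [set 0]) ?inf1 //.
      apply/seteqP; split=> [_ [t _ <-]|_ ->]; rewrite ?sublinear0 //; first exact: (svalP t).1.
      by exists t0; rewrite ?sublinear0 //; exact: (svalP t0).1.
    apply/eqP; rewrite eq_le (gZ _ _ (ltW a0)) /=.
    have ai0 : 0 <= a^-1 by rewrite invr_ge0 (ltW a0).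
    have := gZ _ (a *: x) ai0; rewrite scalerA mulVf ?gt_eqF // scale1r.
    by rewrite -(ler_pM2l a0) mulrA divff ?gt_eqF // mul1r.
  have gq x : g x <= q x by apply: le_trans (gle t0 x At0) ((svalP t0).2 x).
  by exists (exist _ g (conj sg gq)) => s As; apply/asboolP => x; exact: gle.
- have [sm mq] := svalP m.
  exists (sval m) => //; apply: minimal_sublinear => // p sp pm.
  have pq x : p x <= q x by exact: le_trans (pm x) (mq x).
  have := mmax (exist _ p (conj sp pq)).
  by move=> H; rewrite -H //; apply/asboolP.
Qed.

(** A linear [f] below the perturbed function inherits the constraints, since
    [f u.1 = - f (- u.1)]. *)
Theorem hahn_banach_cone q S : sublinear q -> cone S ->
  (forall u, S u -> u.2 <= q u.1) ->
  exists f, [/\ linearf f, forall x, f x <= q x & forall u, S u -> u.2 <= f u.1].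
Proof.
move=> sq cS Sq; have [p [sp pq pS]] := cone_perturb sq cS Sq.
have [f lf fp] := hahn_banach sp; exists f; split=> // [x|u Su].
  exact: le_trans (fp x) (pq x).
have f0 : f 0 = 0 by have := lf 1 0 0; rewrite scaler0 addr0; lra.
have := fp (- u.1); have := lf (- 1) u.1 0; rewrite scaleN1r !addr0 f0 => ->.
by have := pS u Su; lra.
Qed.

End HahnBanach.

(** * Completion of a seminormed space *)

Section Completion.
Variables (R : realType) (E : lmodType R) (p : E -> R).

(* The completion is realized inside the functions on the dual ball: uniform
   limits of evaluations. *)
Definition dual_ball := {f : E -> R | linearf f /\ forall x, f x <= p x}.

Definition evalf (e : E) : dual_ball -> R := fun f => sval f e.

Definition eval_closure : {pred dual_ball -> R} :=
  [pred g | `[< forall eps : R, 0 < eps ->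
     exists e, forall f, `|g f - evalf e f| <= eps >] ].

Lemma eval_closureP g : reflect (forall eps : R, 0 < eps ->
     exists e, forall f, `|g f - evalf e f| <= eps) (g \in eval_closure).
Proof. exact: asboolP. Qed.

Lemma evalfD a u v f : evalf (a *: u + v) f = a * evalf u f + evalf v f.
Proof. exact: (svalP f).1. Qed.

Fact eval_closure_submod : submod_closed eval_closure.
Proof.
split=> [|a g h /eval_closureP gP /eval_closureP hP].
  apply/eval_closureP => eps e0; exists 0 => f.
  have := evalfD 1 0 0 f; rewrite scaler0 addr0 => H.
  have -> : evalf 0 f = 0 by lra.
  by rewrite subr0 normr0 ltW.
apply/eval_closureP => eps e0.
have a1 : 0 < `|a| + 1 by rewrite ltr_wpDl.
have [|u ug] := gP (eps / 2 / (`|a| + 1)); first by rewrite !divr_gt0.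
have [|v vh] := hP (eps / 2); first by rewrite divr_gt0.
exists (a *: u + v) => f; rewrite evalfD.
have -> : (a *: g + h) f - (a * evalf u f + evalf v f) =
  a * (g f - evalf u f) + (h f - evalf v f).
  have -> : (a *: g + h) f = a * g f + h f by [].
  ring.
apply: (le_trans (ler_normD _ _)); rewrite [leRHS](splitr eps) lerD //.
rewrite normrM; apply: (@le_trans _ _ (`|a| * (eps / 2 / (`|a| + 1)))).
  by rewrite ler_wpM2l.
rewrite mulrCA ger_pMr ?divr_gt0 // ler_pdivrMr // mul1r; lra.
Qed.

HB.instance Definition _ :=
  GRing.isSubmodClosed.Build R (dual_ball -> R) eval_closure eval_closure_submod.

Definition compl := {g : dual_ball -> R | g \in eval_closure}.

HB.instance Definition _ := SubChoice.on compl.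
HB.instance Definition _ := [SubChoice_isSubLmodule of compl by <:].

(** The supremum norm over the dual ball, as an infimum of bounds. A bound exists because [g] is
    uniformly close to an evaluation, itself bounded by [p]. *)
Let bounds (g : compl) := [set c : R | 0 <= c /\ forall f, `|val g f| <= c].

Definition compl_norm (g : compl) := inf (bounds g).

Let bounds_lb g : has_lbound (bounds g).
Proof. by exists 0 => c []. Qed.

Hypotheses (pD : forall x y, p (x + y) <= p x + p y)
  (pZ : forall a x, p (a *: x) = `|a| * p x).

Lemma semi_ge0 x : 0 <= p x.
Proof.
have p0 : p 0 = 0 by have := pZ 0 0; rewrite scale0r normr0 mul0r.
have := pD x (-1 *: x); rewrite pZ normrN1 mul1r scaleN1r subrr p0; lra.
Qed.

Lemma dual_ball_le f x : `|evalf x f| <= p x.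
Proof.
have [lf fp] := svalP f.
rewrite ler_norml fp andbT.
have := fp (- 1 *: x); rewrite pZ normrN1 mul1r.
have := lf (- 1) x 0; have := lf 1 0 0; rewrite scaler0 !addr0 /evalf; lra.
Qed.

Let bounds_ne g : bounds g !=set0.
Proof.
have [e ge] := elimT (eval_closureP _) (valP g) 1 ltr01.
exists (1 + p e); split=> [|f]; first by rewrite addr_ge0 // semi_ge0.
have -> : val g f = (val g f - evalf e f) + evalf e f by ring.
by apply: (le_trans (ler_normD _ _)); rewrite lerD // dual_ball_le.
Qed.

Lemma compl_normP g f : `|val g f| <= compl_norm g.
Proof. by apply: lb_le_inf => // c [_]. Qed.

Lemma compl_norm_le g c : 0 <= c -> (forall f, `|val g f| <= c) ->
  compl_norm g <= c.
Proof. by move=> c0 gc; apply: ge_inf => //; split. Qed.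

Lemma compl_norm_ge0 g : 0 <= compl_norm g.
Proof. by apply: lb_le_inf => // c []. Qed.

Lemma compl_normD g h : compl_norm (g + h) <= compl_norm g + compl_norm h.
Proof.
apply: compl_norm_le => [|f]; first by rewrite addr_ge0 ?compl_norm_ge0.
rewrite [val _ f]/(val g f + val h f).
by apply: (le_trans (ler_normD _ _)); rewrite lerD // compl_normP.
Qed.

Lemma compl_normZ a g : compl_norm (a *: g) = `|a| * compl_norm g.
Proof.
have le b h : compl_norm (b *: h) <= `|b| * compl_norm h.
  apply: compl_norm_le => [|f]; first by rewrite mulr_ge0 ?compl_norm_ge0.
  by rewrite [val _ f]/(b * val h f) normrM ler_wpM2l // compl_normP.
have [->|a0] := eqVneq a 0.
  apply/eqP; rewrite eq_le le /= normr0 mul0r; exact: compl_norm_ge0.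
apply/eqP; rewrite eq_le le /=.
have := le a^-1 (a *: g); rewrite scalerA mulVf // scale1r normfV.
by rewrite mulrC ler_pdivlMr ?normr_gt0 // mulrC.
Qed.

Lemma compl_norm0_eq0 g : compl_norm g = 0 -> g = 0.
Proof.
move=> g0; apply/val_inj/funext => f /=.
by apply/eqP; rewrite -normr_le0 -g0 compl_normP.
Qed.

End Completion.

Section CompletionExists.
Variables (R : realType) (E : lmodType R) (p : E -> R).

(* The hypotheses are arguments of the type, for instance inference. *)
Definition complT of (forall x y, p (x + y) <= p x + p y)
  & (forall a x, p (a *: x) = `|a| * p x) := compl p.

Hypotheses (pD : forall x y, p (x + y) <= p x + p y)
  (pZ : forall a x, p (a *: x) = `|a| * p x).

Local Notation T := (complT pD pZ).

HB.instance Definition _ := GRing.Lmodule.on T.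
HB.instance Definition _ := @Lmodule_isNormed.Build R T (@compl_norm R E p)
  (compl_normD pD pZ) (compl_normZ pD pZ) (@compl_norm0_eq0 R E p pD pZ).

Lemma compl_complete (F : set_system T) : ProperFilter F -> cauchy F -> cvg F.
Proof.
move=> FF /cauchyP Fc.
have {}Fc eps : 0 < eps -> exists x : T, F [set y | `|x - y| < eps].
  by move=> e0; have [x] := Fc _ e0; exists x.
have dist (x y : T) f : `|(val x : _ -> R) f - (val y : _ -> R) f| <= `|x - y|.
  exact: (compl_normP pD pZ (x - y)).
(* Pointwise limits exist in [R]. The estimate involves the same [eps] and [x] for every [f], which
   makes the convergence uniform on the dual ball. *)
have lim f : exists l : R, forall eps x, 0 < eps -> F [set y : T | `|x - y| < eps] ->
    `|(val x : _ -> R) f - l| <= eps.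
  pose G := (fun x : T => (val x : _ -> R) f) @ F.
  have : cvg G.
    apply: cauchy_cvg; apply: cauchy_exP => eps e0.
    have [x Fx] := Fc _ e0; exists ((val x : _ -> R) f).
    have : F [set y : T | `|(val x : _ -> R) f - (val y : _ -> R) f| < eps].
      by apply: filterS Fx => y; apply: le_lt_trans; exact: dist.
    exact: id.
  move=> /cvg_ex [l Gl]; exists l => eps x e0 Fx.
  apply/ler_addgt0Pr => d d0.
  move/cvgrPdist_lt/(_ d d0) : Gl => Gl.
  have [y [/= h1 h2]] := filter_ex (filterI Fx Gl).
  have := ler_distD ((val y : _ -> R) f) ((val x : _ -> R) f) l.
  by have := dist x y f; rewrite (distrC l) in h2; lra.
pose L f := projT1 (cid (lim f)).
have LP f : forall eps x, 0 < eps -> F [set y : T | `|x - y| < eps] ->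
    `|(val x : _ -> R) f - L f| <= eps := projT2 (cid (lim f)).
have Lc : L \in @eval_closure R E p.
  apply/eval_closureP => eps e0.
  have e20 : 0 < eps / 2 by rewrite divr_gt0.
  have [x Fx] := Fc _ e20.
  have [e xe] := elimT (eval_closureP _) (valP x) _ e20.
  exists e => f; have := ler_distD ((val x : _ -> R) f) (L f) (evalf e f).
  by have := xe f; have := LP f _ x e20 Fx; rewrite (distrC (L f) ((val x : _ -> R) f)); lra.
apply/cvg_ex; exists (Sub L Lc : T); apply/cvgrPdist_lt => eps e0.
have e30 : 0 < eps / 3 by rewrite divr_gt0.
have [x Fx] := Fc _ e30; apply: filterS (Fx) => y /= xy.
have : `|(Sub L Lc : T) - x| <= eps / 3.
  apply: (@compl_norm_le R E p) => [|f]; first exact: ltW.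
  by rewrite [\val _ f]/(L f - (val x : _ -> R) f) distrC; apply: (LP f _ x e30 Fx).
have := ler_distD x (Sub L Lc : T) y; lra.
Qed.

HB.instance Definition _ := Uniform_isComplete.Build T compl_complete.

Theorem completion_exists : exists (X : completeNormedModType R) (j : E -> X),
  [/\ forall a u v, j (a *: u + v) = a *: j u + j v,
      forall e, `|j e| = p e & closure (range j) = setT].
Proof.
have jc e : evalf (p := p) e \in @eval_closure R E p.
  by apply/eval_closureP => eps e0; exists e => f; rewrite subrr normr0 ltW.
exists T, (fun e => Sub (evalf e) (jc e)); split.
- by move=> a u v; apply/val_inj/funext => f /=; exact: evalfD.
- move=> e; apply/eqP; rewrite eq_le; apply/andP; split.
    by apply: (@compl_norm_le R E p) => [|f]; [exact: semi_ge0|exact: dual_ball_le].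
  have sp : sublinear p by split=> // a x a0; rewrite pZ ger0_norm.
  (* A norming functional: the ray through [(e, p e)] gives [f <= p] with [f e >= p e]. *)
  have [|f [lf fp fe]] := @hahn_banach_cone _ _ p _ sp (ray_cone e sp).
    by move=> _ [t t0 ->] /=; rewrite sp.2.
  pose F : dual_ball p := exist _ f (conj lf fp).
  apply: le_trans (compl_normP pD pZ _ F).
  apply: le_trans (ler_norm _).
  by apply: (fe (e, p e)); exists 1; rewrite ?ler01 // scale1r mul1r.
- apply/seteqP; split=> // x _ U /nbhs_ballP [eps e0 eU].
  have e20 : 0 < eps / 2 by rewrite divr_gt0.
  have [e xe] := elimT (eval_closureP _) (valP x) _ e20.
  exists (Sub (evalf e) (jc e) : T); split; first by exists e.
  apply: eU; rewrite -ball_normE /=.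
  apply: (@le_lt_trans _ _ (eps / 2)); last lra.
  by apply: (@compl_norm_le R E p); [exact: ltW|exact: xe].
Qed.

End CompletionExists.

(** * Seminorms on V and on c00 *)

Section FiniteSupport.
Variable R : realType.
Implicit Types (x y : nat -> R) (u v : V) (q : rat).

Lemma finsupp_lin (T : pzRingType) (a : T) (x y : nat -> T) :
  finsupp x -> finsupp y -> finsupp (fun n => a * x n + y n).
Proof.
move=> [M xM] [N yN]; exists (maxn M N) => n; rewrite geq_max => /andP[Mn Nn].
by rewrite xM // yN // mulr0 addr0.
Qed.

Lemma finsupp0 (T : zmodType) : finsupp (fun=> 0 : T).
Proof. by exists 0%N. Qed.

Lemma c00Z a x : c00 x -> c00 (fun n => a * x n).
Proof. by move=> [N xN]; exists N => n /xN ->; rewrite mulr0. Qed.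

Lemma c00B x y : c00 x -> c00 y -> c00 (fun n => x n - y n).
Proof.
move=> cx cy; have := finsupp_lin (- 1) cy cx.
by congr c00; apply/funext => n; rewrite mulN1r addrC.
Qed.

Lemma c00_ratseq v : c00 (ratseq R v).
Proof. by case: v => x [N xN]; exists N => n /xN /= ; rewrite /ratseq /= => ->; rewrite rmorph0. Qed.

Definition unit_seq (i : nat) : nat -> R := fun n => (n == i)%:R.

Lemma c00_unit i : c00 (unit_seq i).
Proof. by exists i.+1 => n ni; rewrite /unit_seq gtn_eqF. Qed.

Lemma V_inj u v : sval u = sval v -> u = v.
Proof. by case: u v => [x hx] [y hy] /= xy; apply: eq_exist. Qed.

Definition vlin q u v : V := exist _ _ (finsupp_lin q (proj2_sig u) (proj2_sig v)).
Definition vzero : V := exist _ _ (finsupp0 rat).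

Fact vunit_proof (i : nat) : finsupp (fun n => (n == i)%:R : rat).
Proof. by exists i.+1 => n ni; rewrite gtn_eqF. Qed.
Definition vunit i : V := exist _ _ (vunit_proof i).

Lemma ratseq_lin q u v :
  ratseq R (vlin q u v) = fun n => ratr q * ratseq R u n + ratseq R v n.
Proof. by apply/funext => n; rewrite /ratseq /= rmorphD rmorphM. Qed.

Lemma ratseq0 : ratseq R vzero = fun=> 0.
Proof. by apply/funext => n; rewrite /ratseq /= rmorph0. Qed.

Lemma ratseq_unit i : ratseq R (vunit i) = unit_seq i.
Proof. by apply/funext => n; rewrite /ratseq /= ratr_nat. Qed.

Section Seminorm.
Variable m : (nat -> R) -> R.
Hypothesis sm : seminorm_c00 m.

Lemma semi0 : m (fun=> 0) = 0.
Proof.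
have -> : (fun=> 0) = (fun n : nat => 0 * (fun=> 0 : R) n).
  by apply/funext => n; rewrite mul0r.
by rewrite (sm.2 0 _ (finsupp0 R)) normr0 mul0r.
Qed.

Lemma semi_lin a x y : c00 x -> c00 y ->
  m (fun n => a * x n + y n) <= `|a| * m x + m y.
Proof. by move=> cx cy; rewrite -(sm.2 _ _ cx); apply: sm.1 => //; exact: c00Z. Qed.

Lemma semiN x : c00 x -> m (fun n => - x n) = m x.
Proof.
move=> cx; rewrite -[RHS]mul1r -(normrN1 R) -(sm.2 _ _ cx); congr m.
by apply/funext => n; rewrite mulN1r.
Qed.

Lemma semi_c00_ge0 x : c00 x -> 0 <= m x.
Proof.
move=> cx; have := semi_lin (- 1) cx cx; rewrite normrN1 mul1r.
rewrite (_ : (fun n => _) = fun=> 0) ?semi0; first lra.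
by apply/funext => n; rewrite mulN1r addNr.
Qed.

Lemma semi_tri x y : c00 x -> c00 y -> m x <= m y + m (fun n => x n - y n).
Proof.
move=> cx cy; have := sm.1 _ _ cy (c00B cx cy); apply: le_trans.
by rewrite le_eqVlt; apply/orP; left; apply/eqP; congr m; apply/funext => n; ring.
Qed.

Lemma semi_distC x y : c00 x -> c00 y ->
  m (fun n => x n - y n) = m (fun n => y n - x n).
Proof.
move=> cx cy; rewrite -(semiN (c00B cx cy)); congr m.
by apply/funext => n; rewrite opprB.
Qed.

Lemma semi_subl x y : c00 x -> c00 y -> m (fun n => x n - y n) <= m x + m y.
Proof.
move=> cx cy; have := semi_lin (- 1) cy cx; rewrite normrN1 mul1r addrC.
by apply: le_trans; rewrite le_eqVlt; apply/orP; left; apply/eqP; congr m; apply/funext => n; ring.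
Qed.

Lemma semi_coord N x : (forall n, (N <= n)%N -> x n = 0) ->
  m x <= \sum_(i < N) `|x i| * m (unit_seq i).
Proof.
elim: N x => [|N IH] x xN.
  by rewrite big_ord0 (_ : x = fun=> 0) ?semi0 //; apply/funext => n; exact: xN.
rewrite big_ord_recr /=.
pose y n := if (n < N)%N then x n else 0.
have yN n : (N <= n)%N -> y n = 0 by rewrite /y ltnNge => ->.
have -> : m x = m (fun n => x N * unit_seq N n + y n).
  congr m; apply/funext => n; rewrite /unit_seq /y; case: (ltngtP n N) => [nN|nN|->].
  - by rewrite mulr0 add0r.
  - by rewrite mulr0 add0r xN.
  - by rewrite mulr1 addr0.
apply: (le_trans (semi_lin _ (c00_unit N) _)); first by exists N.
rewrite [leLHS]addrC lerD2r.
by apply: (le_trans (IH _ yN)); apply: ler_sum => i _; rewrite /y ltn_ord.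
Qed.

Lemma ratseq_dense x e : c00 x -> 0 < e ->
  exists v, m (fun n => x n - ratseq R v n) < e.
Proof.
move=> [N xN] e0.
(* [C] exceeds the total seminorm of the unit vectors involved, so coordinate errors of [e / C] add
   up to less than [e]. *)
pose C := \sum_(i < N) m (unit_seq i) + 1.
have C0 : 0 < C by rewrite ltr_wpDl // sumr_ge0 // => i _; exact: semi_c00_ge0 (c00_unit i).
have ap i : exists q : rat, `|x i - ratr q| <= e / C.
  have [|q qx] := @rat_in_itvoo R (x i) (x i + e / C).
    by rewrite ltrDl divr_gt0.
  by exists q; move: qx; rewrite in_itv /= => /andP[? ?]; rewrite ler_norml; lra.
pose f i := projT1 (cid (ap i)).
have fP i : `|x i - ratr (f i)| <= e / C := projT2 (cid (ap i)).
have fN : finsupp (fun n => if (n < N)%N then f n else 0).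
  by exists N => n; rewrite ltnNge => ->.
exists (exist _ _ fN).
apply: (@le_lt_trans _ _ (\sum_(i < N) e / C * m (unit_seq i))).
  apply: (le_trans (semi_coord (N := N) _)) => [n Nn|].
    by rewrite xN // /ratseq /= ltnNge Nn rmorph0 subr0.
  apply: ler_sum => i _; rewrite /ratseq /= ltn_ord.
  by apply: ler_wpM2r; [exact: semi_c00_ge0 (c00_unit i)|exact: fP].
rewrite -mulr_sumr -[ltRHS](@divfK _ C) ?gt_eqF //.
by rewrite ltr_pM2l ?divr_gt0 // ltrDl.
Qed.

End Seminorm.

Lemma seminorm_sum (m1 m2 : (nat -> R) -> R) :
  seminorm_c00 m1 -> seminorm_c00 m2 -> seminorm_c00 (fun x => m1 x + m2 x).
Proof.
move=> s1 s2; split=> [x y cx cy|a x cx].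
  by have := s1.1 x y cx cy; have := s2.1 x y cx cy; lra.
by rewrite s1.2 // s2.2 // mulrDr.
Qed.

(** The sum of the two extensions is a seminorm, so one rational vector is close to [x] for both,
    and there they agree. *)
Lemma mubar_unique mu m1 m2 : mubar_of mu m1 -> mubar_of mu m2 ->
  forall x, c00 x -> m1 x = m2 x.
Proof.
suff le n1 n2 x : mubar_of mu n1 -> mubar_of mu n2 -> c00 x -> n1 x <= n2 x.
  by move=> h1 h2 x cx; apply/eqP; rewrite eq_le !le.
move=> [s1 e1] [s2 e2] cx; apply: (@ler_addeps _ _ _ 1) => e e0.
have [v] := ratseq_dense (seminorm_sum s1 s2) cx e0.
have cv := c00_ratseq v.
have := semi_tri s1 cx cv; have := semi_tri s2 cv cx.
by rewrite (semi_distC s2 cv cx) e1 e2; lra.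
Qed.

End FiniteSupport.

(** * Extension of a seminorm from [V] to c00 *)

Section Extension.
Variables (R : realType) (mu : V -> R).
Hypothesis smu : seminorm_V mu.

Lemma mu_lin q u v : mu (vlin q u v) <= `|ratr q| * mu u + mu v.
Proof.
rewrite -ratr_norm -(smu.2 q u (vlin q u vzero)).
  by apply: smu.1; apply/funext => n /=; rewrite addr0.
by apply/funext => n /=; rewrite addr0.
Qed.

Lemma mu_zero : mu vzero = 0.
Proof.
by rewrite (smu.2 0 vzero vzero) ?normr0 ?rmorph0 ?mul0r.
Qed.

Lemma mu_ge0 u : 0 <= mu u.
Proof.
have := mu_lin (- 1) u u; rewrite rmorphN1 normrN1 mul1r.
rewrite (_ : vlin _ _ _ = vzero) ?mu_zero; first lra.
by apply: V_inj; apply/funext => n /=; rewrite mulN1r addNr.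
Qed.

Let c i := mu (vunit i).
Let c0 i : 0 <= c i := mu_ge0 (vunit i).

(** A Lipschitz bound for a weighted l1 distance, obtained by correcting one coordinate at a time
    with a rational multiple of a unit vector. *)
Lemma mu_coord N u v : (forall n, (N <= n)%N -> sval u n = sval v n) ->
  mu u <= mu v + \sum_(i < N) `|ratseq R u i - ratseq R v i| * c i.
Proof.
elim: N v => [|N IH] v uv.
  rewrite big_ord0 addr0 (_ : u = v) //; apply: V_inj; apply/funext => n.
  exact: uv.
pose w := vlin (sval u N - sval v N) (vunit N) v.
have uw n : (N <= n)%N -> sval u n = sval w n.
  rewrite leq_eqVlt => /orP[/eqP<-|Nn] /=.
    by rewrite eqxx mulr1 subrK.
  by rewrite gtn_eqF // mulr0 add0r uv.
apply: (le_trans (IH w uw)); rewrite big_ord_recr /= addrA addrAC.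
rewrite (eq_bigr (fun i : 'I_N => `|ratseq R u i - ratseq R v i| * c i)).
  rewrite lerD2r addrC; apply: (le_trans (mu_lin _ _ _)).
  by rewrite rmorphB.
by move=> i _; rewrite ratseq_lin ratseq_unit /unit_seq ltn_eqF // mulr0 add0r.
Qed.

Let w N (x y : nat -> R) := \sum_(i < N) `|x i - y i| * c i.

Let w_widen N M x y : (N <= M)%N -> (forall n, (N <= n)%N -> x n = y n) ->
  w M x y = w N x y.
Proof.
move=> NM xy; rewrite /w (big_ord_widen _ (fun i => `|x i - y i| * c i) NM) [RHS]big_mkcond /=.
apply: eq_bigr => i _; case: ltnP => // Ni.
by rewrite xy // subrr normr0 mul0r.
Qed.

(** Infimal convolution of [mu] with the weighted l1 distance. By the Lipschitz bound [mu_coord],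
    the infimum gives back [mu] at rational sequences. *)
Let vals x := [set s | exists v N, (forall n, (N <= n)%N -> x n = ratseq R v n) /\
  s = mu v + w N x (ratseq R v)].

Let ext x := inf (vals x).

Let w_ge0 N x y : 0 <= w N x y.
Proof. by apply: sumr_ge0 => i _; rewrite mulr_ge0. Qed.

Let vals_lb x : has_lbound (vals x).
Proof. by exists 0 => _ [v [N [_ ->]]]; rewrite addr_ge0 ?mu_ge0. Qed.

Let vals_ne x : c00 x -> vals x !=set0.
Proof.
move=> [N xN]; exists (mu vzero + w N x (ratseq R vzero)), vzero, N; split=> //.
by move=> n Nn; rewrite ratseq0 xN.
Qed.

Let ext_le x v N : (forall n, (N <= n)%N -> x n = ratseq R v n) ->
  ext x <= mu v + w N x (ratseq R v).
Proof. by move=> xv; apply: ge_inf => //; exists v, N. Qed.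

Let ext_adh x e : c00 x -> 0 < e -> exists v N,
  (forall n, (N <= n)%N -> x n = ratseq R v n) /\
  mu v + w N x (ratseq R v) < ext x + e.
Proof.
move=> cx e0; have [_ [v [N [xv ->]]] ?] := inf_adherent e0 (conj (vals_ne cx) (@vals_lb x)).
by exists v, N.
Qed.

Let ext_ge0 x : c00 x -> 0 <= ext x.
Proof.
move=> cx; apply: lb_le_inf; first exact: vals_ne.
by move=> _ [v [N [_ ->]]]; rewrite addr_ge0 ?mu_ge0.
Qed.

Let ext_ratseq v : ext (ratseq R v) = mu v.
Proof.
apply/eqP; rewrite eq_le; apply/andP; split.
  by have := @ext_le (ratseq R v) v 0; rewrite /w big_ord0 addr0; exact.
apply: lb_le_inf; first by apply: vals_ne; exact: c00_ratseq.
move=> _ [u [N [vu ->]]]; apply: mu_coord => n /vu.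
by move/(fmorph_inj (@ratr R)).
Qed.

Let ext_add x y : c00 x -> c00 y -> ext (fun n => x n + y n) <= ext x + ext y.
Proof.
move=> cx cy; apply: (@ler_addeps _ _ _ 2) => e e0.
have [u [M [xu hu]]] := ext_adh cx e0.
have [v [N [yv hv]]] := ext_adh cy e0.
have luv : ratseq R (vlin 1 u v) = fun n => ratseq R u n + ratseq R v n.
  by rewrite ratseq_lin; apply/funext => n; rewrite rmorph1 mul1r.
have /ext_le : forall n, (maxn M N <= n)%N -> x n + y n = ratseq R (vlin 1 u v) n.
  by move=> n; rewrite geq_max luv => /andP[? ?]; rewrite xu // yv.
move/le_trans; apply.
have := mu_lin 1 u v; rewrite rmorph1 normr1 mul1r.
have : w (maxn M N) (fun n => x n + y n) (ratseq R (vlin 1 u v)) <=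
    w (maxn M N) x (ratseq R u) + w (maxn M N) y (ratseq R v).
  rewrite -big_split; apply: ler_sum => i _ /=.
  rewrite -mulrDl; apply: ler_wpM2r => //; rewrite luv.
  by rewrite opprD addrACA ler_normD.
rewrite (w_widen (leq_maxl M N) xu) (w_widen (leq_maxr M N) yv); lra.
Qed.

(* The infimum only sees rational multiples directly; a real scalar is
   approximated by a rational one, at a cost proportional to the error. *)
Let ext_scale_le a x : c00 x -> ext (fun n => a * x n) <= `|a| * ext x.
Proof.
move=> cx; apply: (@ler_addeps _ _ _ (`|a|)) => e e0.
have [v [N [xv hv]]] := ext_adh cx e0.
have {hv} : `|a| * (mu v + w N x (ratseq R v)) <= `|a| * ext x + e * `|a|.
  by rewrite [e * _]mulrC -mulrDr ler_wpM2l // ltW.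
apply: le_trans.
(* Past [L] both [x] and [v] vanish, so that [a * x] and its approximation [q * v] agree there. *)
have [M vM] := c00_ratseq R v; pose L := maxn N M.
pose B := w L (ratseq R v) (fun=> 0).
apply: (@ler_addeps _ _ _ (mu v + B)) => d d0.
have [|q qa] := @rat_in_itvoo R a (a + d); first by rewrite ltrDl.
have {}qa : `|a - ratr q| <= d.
  by move: qa; rewrite in_itv /= => /andP[? ?]; rewrite ler_norml; lra.
pose z := vlin q v vzero.
have zE n : ratseq R z n = ratr q * ratseq R v n.
  by rewrite ratseq_lin ratseq0 addr0.
have /ext_le : forall n, (L <= n)%N -> a * x n = ratseq R z n.
  by move=> n; rewrite geq_max zE => /andP[? ?]; rewrite xv // vM // !mulr0.
move/le_trans; apply.
have : mu z <= (`|a| + d) * mu v.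
  have := mu_lin q v vzero; rewrite mu_zero addr0 => /le_trans; apply.
  apply: ler_wpM2r; first exact: mu_ge0.
  have := ler_normB a (a - ratr q); rewrite opprB addrC subrK; lra.
have : w L (fun n => a * x n) (ratseq R z) <= `|a| * w L x (ratseq R v) + d * B.
  rewrite /B /w !mulr_sumr -big_split; apply: ler_sum => i _ /=.
  rewrite !mulrA -mulrDl; apply: ler_wpM2r => //.
  rewrite subr0 zE (_ : a * x i - _ = a * (x i - ratseq R v i) + (a - ratr q) * ratseq R v i); last by ring.
  apply: (le_trans (ler_normD _ _)); rewrite !normrM lerD2l.
  exact: ler_wpM2r.
rewrite (w_widen (leq_maxl N M) xv); lra.
Qed.

Theorem mubar_exists : exists m, mubar_of mu m.
Proof.
exists ext; split; last exact: ext_ratseq.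
split; first exact: ext_add.
move=> a x cx; apply/eqP; rewrite eq_le ext_scale_le //=.
have [->|a0] := eqVneq a 0.
  by rewrite normr0 mul0r; apply: ext_ge0; exact: c00Z.
have := ext_scale_le a^-1 (c00Z a cx).
rewrite (_ : (fun n => _) = x) => [h|]; last first.
  by apply/funext => n; rewrite mulrA mulVf // mul1r.
by move: h; rewrite normfV mulrC ler_pdivlMr ?normr_gt0 // mulrC.
Qed.

End Extension.

(** * Completions of c00 *)

Section CompletionC00.
Variable R : realType.

Definition c00_pred : {pred nat -> R} := [pred x | `[< c00 x >] ].

Fact c00_submod : submod_closed c00_pred.
Proof.
split=> [|a x y /asboolP cx /asboolP cy]; apply/asboolP; first exact: finsupp0.
exact: finsupp_lin.
Qed.

HB.instance Definition _ :=
  GRing.isSubmodClosed.Build R (nat -> R) c00_pred c00_submod.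

Definition c00_space := {x : nat -> R | x \in c00_pred}.
HB.instance Definition _ := SubChoice.on c00_space.
HB.instance Definition _ := [SubChoice_isSubLmodule of c00_space by <:].

Theorem completion_c00_exists (m : (nat -> R) -> R) : seminorm_c00 m ->
  exists (X : completeNormedModType R) (j : (nat -> R) -> X), completion_of m j.
Proof.
move=> sm; have c (e : c00_space) : c00 (val e) by exact: (elimT (asboolP _) (valP e)).
have pD (x y : c00_space) : m (val (x + y)) <= m (val x) + m (val y) by exact: sm.1.
have pZ a (x : c00_space) : m (val (a *: x)) = `|a| * m (val x) by exact: sm.2.
have [X [j [jl jm jd]]] := completion_exists pD pZ.
have ins x : c00 x -> val (insubd (0 : c00_space) x) = x.
  by move=> cx; rewrite insubdK //; apply/asboolP.
(* Sequences outside c00 are sent to [j 0]; [completion_of] constrains the map on c00 only. *)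
exists X, (fun x => j (insubd 0 x)); split=> [a x y cx cy|]; [|split=> [x cx|]].
- rewrite -jl; congr j; apply: val_inj; rewrite ins; last exact: finsupp_lin.
  transitivity (fun n => a * val (insubd (0 : c00_space) x) n +
      val (insubd (0 : c00_space) y) n); last by [].
  by rewrite !ins.
- by rewrite jm ins.
- rewrite -jd; congr closure; apply/seteqP; split=> _ [x cx <-]; first by exists (insubd 0 x).
  by exists (val x) => //; congr j; apply: val_inj; rewrite ins.
Qed.

End CompletionC00.

(** * An averaging criterion for the Daugavet property *)

Section Criterion.
Variable R : realType.

Definition vsub (x d : V) : V := vlin (- 1) d x.

(** The length of [s] times the difference between [y] and the mean of [s]. *)
Definition vdev (y : V) (s : seq V) : V :=
  foldr (fun d w => vlin 1 (vsub y d) w) vzero s.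

Lemma ratseq_sub x d : ratseq R (vsub x d) = fun n => ratseq R x n - ratseq R d n.
Proof. by rewrite ratseq_lin; apply/funext => n; rewrite rmorphN1 mulN1r addrC. Qed.

Definition good (mu : V -> R) (e : R) (x d : V) :=
  (mu d < 1) && (mu x + 1 - e < mu (vsub x d)).

(* The unit ball is approximated by averages of points almost at maximal
   distance from x; averages are replaced by unweighted sums to stay in V. *)
Definition crit_at (e : R) (x y : V) (mu : V -> R) :=
  [\/ mu x < e, 1 - e < mu y |
   exists s : seq V, [/\ (0 < size s)%N, all (good mu e x) s &
     mu (vdev y s) < (size s)%:R * e] ].

Definition crit (mu : V -> R) :=
  forall x y (k : nat), crit_at k.+1%:R^-1 x y mu.

Section CompletionFacts.
Variables (m : (nat -> R) -> R) (X : completeNormedModType R) (j : (nat -> R) -> X).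
Hypotheses (sm : seminorm_c00 m) (cj : completion_of m j).
Let jl := cj.1.
Let jm := cj.2.1.
Let jd := cj.2.2.

Lemma compl_sub x y : c00 x -> c00 y -> j (fun n => x n - y n) = j x - j y.
Proof.
move=> cx cy; rewrite (_ : (fun n => _) = fun n => -1 * y n + x n).
  by rewrite jl // scaleN1r addrC.
by apply/funext => n; rewrite mulN1r addrC.
Qed.

Lemma compl_zero : j (fun=> 0) = 0.
Proof. by apply/eqP; rewrite -normr_eq0 (jm (finsupp0 R)) semi0. Qed.

Lemma compl_dense z (e : R) : 0 < e -> exists v, `|z - j (ratseq R v)| < e.
Proof.
move=> e0; have e20 : 0 < e / 2 by rewrite divr_gt0.
have : closure (j @` @c00 R) z by rewrite jd.
move=> /(_ _ (nbhsx_ballx z _ e20)) [_ [[x cx <-]]].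
rewrite -ball_normE /= => zx.
have [v xv] := ratseq_dense sm cx e20; exists v.
move: xv; have cv := c00_ratseq R v.
rewrite -(jm (c00B cx cv)) (compl_sub cx cv) => xv.
have := ler_distD (j x) z (j (ratseq R v)); lra.
Qed.

Lemma compl_vdev y s : j (ratseq R (vdev y s)) =
  \sum_(d <- s) (j (ratseq R y) - j (ratseq R d)).
Proof.
elim: s => [|d s IH]; first by rewrite big_nil ratseq0 compl_zero.
rewrite big_cons -IH /= ratseq_lin rmorph1 jl; try exact: c00_ratseq.
by rewrite scale1r ratseq_sub compl_sub //; exact: c00_ratseq.
Qed.

Lemma linearfN (f : X -> R) z : linearf f -> f (- z) = - f z.
Proof.
move=> lf; have := lf (- 1) z 0; have := lf 1 0 0.
rewrite scaler0 !addr0 scaleN1r; lra.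
Qed.

Lemma linearf0 (f : X -> R) : linearf f -> f 0 = 0.
Proof. by move=> lf; have := lf 1 0 0; rewrite scaler0 addr0; lra. Qed.

Lemma linearfZ (f : X -> R) a z : linearf f -> f (a *: z) = a * f z.
Proof. by move=> lf; rewrite -[a *: z]addr0 lf linearf0 // addr0. Qed.

Lemma linearfB (f : X -> R) u v : linearf f -> f (u - v) = f u - f v.
Proof. by move=> lf; rewrite addrC -scaleN1r lf mulN1r addrC. Qed.

Lemma sup_norm1 (f : X -> R) : linearf f ->
  sup [set `|f y| | y in [set y : X | `|y| <= 1]] = 1 ->
  (forall z, `|f z| <= `|z|) /\
  forall e, 0 < e -> exists y, `|y| <= 1 /\ 1 - e < f y.
Proof.
move=> lf; set A := (X in sup X) => supA.
have hA : has_sup A.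
  (* The value 1 shows that the supremum is a genuine one: a set without supremum has [sup] equal to
     the default 0. *)
  apply: contrapT => /sup_out; rewrite supA => /eqP.
  by rewrite oner_eq0.
split=> [z|e e0].
  have [->|z0] := eqVneq z 0; first by rewrite linearf0 // !normr0.
  have nz : 0 < `|z| by rewrite normr_gt0.
  have : `|f (`|z|^-1 *: z)| <= sup A.
    apply: ub_le_sup; first exact: hA.2.
    exists (`|z|^-1 *: z) => //=.
    by rewrite normrZ normfV normr_id mulVf // gt_eqF.
  rewrite supA linearfZ // normrM normfV normr_id mulrC.
  by rewrite ler_pdivrMr // mul1r.
have [_ [y y1 <-]] := sup_adherent e0 hA; rewrite supA => fy.
have [f0|f0] := leP 0 (f y); first by exists y; rewrite ger0_norm // in fy.
by exists (- y); rewrite normrN linearfN //; rewrite ltr0_norm // in fy.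
Qed.

(** By density it suffices to treat rational [x] and [y]. Taking [y] where [f] almost attains its
    norm, a point [d] that [f] sees almost as well as [y] lies in the slice. *)
Lemma daugavet_slice :
  (forall (x y : V) (f : X -> R) (e : R), linearf f -> (forall z, `|f z| <= `|z|) ->
     0 < e -> e <= m (ratseq R x) -> m (ratseq R y) < 1 ->
     exists d, [/\ c00 d, m d <= 1, f (j (ratseq R y)) - e < f (j d) &
       m (ratseq R x) + 1 - e < m (fun n => ratseq R x n - d n)]) ->
  daugavet X.
Proof.
move=> H eps x f al eps0 x1 lf _ supf al0.
have [fle fap] := sup_norm1 lf supf.
have [|y [y1 fy]] := fap (al / 4); first by rewrite divr_gt0.
(* Shrinking [y] by [1 - t] leaves room for a rational approximation within [t] inside the open unit
   ball. This lowers [f] by at most [2 * t <= al / 4]. *)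
have [t [t0 tal t1]] : exists t : R, [/\ 0 < t, t <= al / 8 & t <= 1/2].
  by exists (Num.min (al / 8) (1 / 2)); rewrite lt_min !ge_min !lexx orbT /= !divr_gt0.
have [v yv] := compl_dense ((1 - t) *: y) t0.
have jv1 : m (ratseq R v) < 1.
  rewrite -jm; last exact: c00_ratseq.
  have := ler_distD ((1 - t) *: y) 0 (j (ratseq R v)).
  rewrite !sub0r !normrN normrZ ger0_norm; last lra.
  have : (1 - t) * `|y| <= (1 - t) * 1 by apply: ler_wpM2l => //; lra.
  lra.
have fv : 1 - al / 2 <= f (j (ratseq R v)).
  have := fle ((1 - t) *: y - j (ratseq R v)).
  rewrite linearfB // linearfZ // => /(le_trans (ler_norm _)).
  have : t * f y <= t * 1.
    by apply: ler_wpM2l; [exact: ltW|have := fle y; have := ler_norm (f y); lra].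
  lra.
(* Three errors of size [e] stay below [eps], and [e <= 1/2] ensures that the approximation [u] of
   the unit vector [x] has seminorm at least [e]. *)
have [e [e0 e1 e2 e3]] : exists e : R, [/\ 0 < e, e <= eps / 4, e <= al / 2 & e <= 1/2].
  exists (Num.min (eps / 4) (Num.min (al / 2) (1 / 2))).
  by rewrite !lt_min !ge_min !lexx !orbT /= !divr_gt0.
have [u xu] := compl_dense x e0.
have cu := c00_ratseq R u.
have mu1 : 1 - e < m (ratseq R u).
  have := ler_distD (j (ratseq R u)) x 0.
  by rewrite -jm // !subr0 x1; lra.
have [|d [cd d1 fd ud]] := H u v f e lf fle e0 _ jv1; first lra.
exists (j d); split; [by rewrite jm|split; first lra].
move: ud; rewrite -(jm (c00B cu cd)) (compl_sub cu cd) => ud.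
have := ler_distD x (j (ratseq R u)) (j d).
rewrite (distrC _ x); lra.
Qed.

End CompletionFacts.

Lemma exists_inv_nat (e : R) : 0 < e -> exists k : nat, k.+1%:R^-1 < e.
Proof.
move=> e0; exists (Num.truncn e^-1).
by rewrite invf_plt ?posrE ?ltr0n // truncnS_gt.
Qed.

(** If [f] were at most [f y - e] at every good point, then [f] would exceed the norm of [vdev y s]
    at that vector. *)
Lemma crit_daugavet (mu : V -> R) : crit mu -> Xmu_daugavet mu.
Proof.
move=> cmu m [sm me] X j cj; apply: (daugavet_slice sm cj).
move=> x y f e lf fle e0; rewrite !me => ex y1.
(* This bound on the tolerance excludes the first two alternatives of [crit_at]. *)
have [k] : exists k : nat, k.+1%:R^-1 < Num.min e (1 - mu y).
  by apply: exists_inv_nat; rewrite lt_min e0 subr_gt0.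
have := cmu x y k; have : 0 < k.+1%:R^-1 :> R by rewrite invr_gt0 ltr0n.
move: (k.+1%:R^-1) => e' e'0; rewrite /crit_at => ce'; rewrite lt_min => /andP[e'e e'y].
have {ce'} [s [s0 gs ms]] : exists s : seq V, [/\ (0 < size s)%N, all (good mu e' x) s &
     mu (vdev y s) < (size s)%:R * e'] by case: ce' => // ?; lra.
have [d gd fd] : exists2 d, good mu e' x d & f (j (ratseq R y)) - e < f (j (ratseq R d)).
  apply: contrapT => nd.
  suff : (size s)%:R * e' <= f (j (ratseq R (vdev y s))).
    have := fle (j (ratseq R (vdev y s))).
    have -> : `|j (ratseq R (vdev y s))| = mu (vdev y s).
      by rewrite -me; apply: cj.2.1; exact: c00_ratseq.
    by move=> /(le_trans (ler_norm _)); lra.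
  rewrite (compl_vdev sm cj); elim: s {s0 ms} gs => [|d s IH] /=.
    by rewrite big_nil linearf0 // mul0r.
  move=> /andP[gd /IH {}IH]; rewrite big_cons.
  have -> : f (j (ratseq R y) - j (ratseq R d) + \sum_(i <- s) (j (ratseq R y) - j (ratseq R i))) =
    f (j (ratseq R y) - j (ratseq R d)) + f (\sum_(i <- s) (j (ratseq R y) - j (ratseq R i))).
    by have := lf 1 (j (ratseq R y) - j (ratseq R d)) (\sum_(i <- s) (j (ratseq R y) - j (ratseq R i))); rewrite scale1r mul1r.
  rewrite linearfB // -natr1 mulrDl mul1r addrC lerD // lerBrDl.
  have [//|] := leP (f (j (ratseq R d)) + e') (f (j (ratseq R y))).
  by move=> lt; exfalso; apply: nd; exists d => //; lra.
have /andP[d1 xd] := gd.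
exists (ratseq R d); rewrite -ratseq_sub !me; split=> //.
- exact: c00_ratseq.
- exact: ltW.
- lra.
Qed.

End Criterion.

(** * The Daugavet property implies the criterion *)

Section DaugavetCriterion.
Variable R : realType.

(** Weights multiplied by [N] are rounded down to natural numbers. Each rounding costs at most 1 in
    the total and [|w d|] in the combination, so the error [C] does not depend on [N]. *)
Lemma nat_weights (X : normedModType R) (w : V -> X) (P : pred V) (l : seq (R * V)) :
  all (fun p => 0 <= p.1) l -> all (fun p => P p.2) l ->
  exists2 C : R, 0 <= C & forall N : nat, exists l' : seq (nat * V),
    [/\ all (fun p => P p.2) l',
      N%:R * (\sum_(p <- l) p.1) - C <= (\sum_(p <- l') p.1)%:R &
      `|\sum_(p <- l') p.1%:R *: w p.2 - N%:R *: \sum_(p <- l) p.1 *: w p.2| <= C].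
Proof.
elim: l => [|[a d] l IH] /=.
  move=> _ _; exists 0 => // N; exists [::].
  by rewrite !big_nil scaler0 mulr0 !subr0 normr0.
move=> /andP[a0 l0] /andP[Pd Pl]; have [C C0 CP] := IH l0 Pl.
exists (C + 1 + `|w d|) => [|N]; first by rewrite !addr_ge0.
have [l' [Pl' hs hn]] := CP N.
have := truncn_itv (mulr_ge0 (ler0n R N) a0); set n := Num.truncn _.
rewrite -natr1 => /andP[n1 n2].
exists ((n, d) :: l') => /=; split; first by rewrite Pd.
  by rewrite !big_cons natrD /= mulrDr; have := normr_ge0 (w d); lra.
rewrite !big_cons /= scalerDr opprD addrACA scalerA -scalerBl.
apply: (le_trans (ler_normD _ _)); rewrite normrZ [leLHS]addrC -[leRHS]addrA lerD //.
rewrite -[leLHS]add0r lerD // ler_piMl //.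
by rewrite ler_norml; lra.
Qed.

Section Avoid.
Variables (X : normedModType R) (w : V -> X) (P : pred V) (e : R).
Hypothesis avoid : forall s : seq V, (0 < size s)%N -> all P s ->
  (size s)%:R * e <= `|\sum_(d <- s) w d|.

Let avoid_nat (l : seq (nat * V)) : all (fun p => P p.2) l ->
  (\sum_(p <- l) p.1)%:R * e <= `|\sum_(p <- l) p.1%:R *: w p.2|.
Proof.
move=> Pl; pose s := flatten [seq nseq p.1 p.2 | p <- l].
have -> : \sum_(p <- l) p.1%:R *: w p.2 = \sum_(d <- s) w d.
  rewrite big_flatten big_map; apply: eq_bigr => p _.
  by rewrite big_nseq iter_addr addr0 scaler_nat.
have -> : (\sum_(p <- l) p.1 = size s)%N.
  rewrite size_flatten /shape -map_comp sumnE big_map.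
  by apply: eq_bigr => p _ /=; rewrite size_nseq.
have [->|s0] := posnP (size s); first by rewrite mul0r.
apply: avoid => //.
rewrite /s; elim: l Pl {s s0} => //= p l IH /andP[Pp /IH {}IH].
by rewrite all_cat all_nseq Pp orbT.
Qed.

(** Natural weights are lists with repetitions. For real weights, a violation would grow linearly in
    [N] while the rounding error of [nat_weights] stays bounded. *)
Lemma avoid_real (l : seq (R * V)) : 0 < e ->
  all (fun p => 0 <= p.1) l -> all (fun p => P p.2) l ->
  e * \sum_(p <- l) p.1 <= `|\sum_(p <- l) p.1 *: w p.2|.
Proof.
move=> e0 l0 Pl; have [C C0 CP] := nat_weights w l0 Pl.
set S := \sum_(p <- l) p.1; set W := \sum_(p <- l) _.
rewrite leNgt; apply/negP => lt.
have g0 : 0 < e * S - `|W| by rewrite subr_gt0.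
have [N] : exists N : nat, C * e + C < N%:R * (e * S - `|W|).
  exists (Num.truncn ((C * e + C) / (e * S - `|W|))).+1.
  by rewrite -ltr_pdivrMr // truncnS_gt.
have [l' [Pl' hs hn]] := CP N.
have := avoid_nat Pl'.
have : (N%:R * S - C) * e <= (\sum_(p <- l') p.1)%:R * e.
  by apply: ler_wpM2r hs; exact: ltW.
have := ler_normD (\sum_(p <- l') p.1%:R *: w p.2 - N%:R *: W) (N%:R *: W).
rewrite subrK normrZ normr_nat; rewrite -/W in hn.
rewrite mulrBr mulrBl (mulrC e) mulrA; lra.
Qed.

End Avoid.

(** For [1 <= c], compare with [c *: (x1 - z)], which differs by [(c - 1) *: z]; for [c < 1],
    compare with [x1 - z], which differs by [(1 - c) *: x1]. *)
Lemma dist_rescale (X : normedModType R) (x1 z : X) (c t : R) : 0 < c -> 0 < t ->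
  `|x1| = 1 -> `|z| <= 1 -> 2 - t < `|x1 - z| ->
  1 + c - (c + 1) * t <= `|c *: x1 - z|.
Proof.
move=> c0 t0 x1n z1 d; have ct : 0 < c * t by rewrite mulr_gt0.
have [c1|c1] := leP 1 c.
  have := ler_normB (c *: x1 - z) ((c - 1) *: z).
  have -> : c *: x1 - z - (c - 1) *: z = c *: (x1 - z).
    by rewrite scalerBl scale1r scalerBr opprB addrA subrK.
  rewrite !normrZ (ger0_norm (ltW c0)) ger0_norm ?subr_ge0 //.
  have : c * (2 - t) < c * `|x1 - z| by rewrite ltr_pM2l.
  have : (c - 1) * `|z| <= (c - 1) * 1 by apply: ler_wpM2l => //; lra.
  lra.
have := ler_normD (c *: x1 - z) ((1 - c) *: x1).
have -> : c *: x1 - z + (1 - c) *: x1 = x1 - z.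
  by rewrite addrAC -scalerDl (addrC c) subrK scale1r.
rewrite normrZ x1n mulr1 ger0_norm; last lra.
lra.
Qed.

Theorem daugavet_crit (mu : V -> R) : seminorm_V mu -> Xmu_daugavet mu -> crit mu.
Proof.
move=> smu dmu x y k.
have : 0 < k.+1%:R^-1 :> R by rewrite invr_gt0 ltr0n.
move: (k.+1%:R^-1) => e e0.
have [m hm] := mubar_exists smu; have [sm me] := hm.
have [X [j cj]] := completion_c00_exists sm.
have dX := dmu m hm X j cj.
have jm v : `|j (ratseq R v)| = mu v by rewrite -me; apply: cj.2.1; exact: c00_ratseq.
have jB u v : j (ratseq R (vsub u v)) = j (ratseq R u) - j (ratseq R v).
  by rewrite ratseq_sub (compl_sub cj) //; exact: c00_ratseq.
apply: contrapT => nc.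
have {nc} [ex ye navoid] : [/\ e <= mu x, mu y <= 1 - e & forall s : seq V,
    (0 < size s)%N -> all (good mu e x) s -> (size s)%:R * e <= mu (vdev y s)].
  split=> [||s s0 gs]; rewrite leNgt; apply/negP => h; apply: nc;
  [exact: Or31|exact: Or32|by apply: Or33; exists s].
have x0 : 0 < mu x by exact: lt_le_trans ex.
pose c := mu x; pose x1 := c^-1 *: j (ratseq R x).
have x1n : `|x1| = 1.
  by rewrite normrZ jm normfV ger0_norm ?mulVf ?gt_eqF // ltW.
have xE : j (ratseq R x) = c *: x1 by rewrite scalerA divff ?scale1r // gt_eqF.
(* Passing from a point [z] of a slice to a rational [d] loses [(c + 1) * t] in [dist_rescale] and
   [2 * t] by approximation, less than [e] in all. *)
pose t := e / (c + 5).
have t0 : 0 < t by rewrite divr_gt0 // addr_gt0.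
have tE : c * t + 5 * t = e by rewrite -mulrDl mulrC divfK // gt_eqF // addr_gt0.
have ct : 0 < c * t by rewrite mulr_gt0.
have t1 : t <= 1 by have := mu_ge0 smu y; lra.
have approx z : `|z| <= 1 -> 2 - t < `|x1 - z| ->
    exists2 d, good mu e x d & `|z - j (ratseq R d)| <= 2 * t.
  move=> z1 xz.
  have [d zd] := compl_dense sm cj ((1 - t) *: z) t0.
  have zz : `|z - (1 - t) *: z| <= t.
    rewrite -{1}[z]scale1r -scalerBl normrZ opprB addrC subrK gtr0_norm //.
    by rewrite ger_pMr.
  have dz : `|z - j (ratseq R d)| <= 2 * t.
    have := ler_distD ((1 - t) *: z) z (j (ratseq R d)); lra.
  exists d => //; rewrite /good; apply/andP; split.
    rewrite -jm; have := ler_distD ((1 - t) *: z) 0 (j (ratseq R d)).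
    rewrite !sub0r !normrN normrZ.
    rewrite ger0_norm ?subr_ge0 //.
    have : (1 - t) * `|z| <= (1 - t) * 1 by apply: ler_wpM2l => //; lra.
    lra.
  rewrite -(jm (vsub x d)) jB xE.
  have := dist_rescale x0 t0 x1n z1 xz; rewrite -/c.
  have := ler_distD (j (ratseq R d)) (c *: x1) z; rewrite (distrC (j _) z) mulrDl; lra.
pose w d := j (ratseq R y) - j (ratseq R d).
(* The cone generated by the constraints [e <= f y - f d], one for each good [d]. *)
pose S := [set u : X * R | exists l : seq (R * V),
  [/\ all (fun p => 0 <= p.1) l, all (fun p => good mu e x p.2) l &
    u = (\sum_(p <- l) p.1 *: w p.2, e * \sum_(p <- l) p.1)] ].
have cS : cone S.
  split.
  - by exists [::]; split=> //; rewrite !big_nil mulr0.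
  - move=> _ _ [l [l0 gl ->]] [l' [l'0 gl' ->]]; exists (l ++ l'); split.
    + by rewrite all_cat l0.
    + by rewrite all_cat gl.
    + by rewrite !big_cat /= mulrDr.
  - move=> a _ a0 [l [l0 gl ->]]; exists [seq (a * p.1, p.2) | p <- l]; split.
    + by rewrite all_map; apply: sub_all l0 => p /= p0; rewrite mulr_ge0.
    + by rewrite all_map; apply: sub_all gl.
    + rewrite !big_map /= -mulr_sumr scaler_sumr mulrCA; congr pair.
      by apply: eq_bigr => p _; rewrite scalerA.
have snorm : sublinear (fun z : X => `|z|).
  by split=> [u v|a u a0]; [exact: ler_normD|rewrite normrZ ger0_norm].
have [u|f [lf fn fS]] := hahn_banach_cone snorm cS.
  move=> [l [l0 gl ->]] /=; apply: avoid_real l0 gl => // s s0 gs.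
  by rewrite -(compl_vdev sm cj) jm; exact: navoid.
have fle z : `|f z| <= `|z|.
  rewrite ler_norml fn andbT -lerNl; rewrite -(linearfN z lf) -(normrN z).
  exact: fn.
have fgood d : good mu e x d -> e <= f (j (ratseq R y)) - f (j (ratseq R d)).
  move=> gd; rewrite -linearfB //.
  have := fS (w d, e); apply; exists [:: (1, d)].
  by rewrite !big_seq1 /= scale1r mulr1 ler01 gd.
pose A := [set `|f y| | y in [set y : X | `|y| <= 1]].
have hA : has_sup A.
  split; first by exists `|f 0|, 0; rewrite //= normr0.
  by exists 1 => _ [z z1 <-]; exact: le_trans (fle z) z1.
have fA z : `|f z| <= sup A * `|z|.
  have [->|z0] := eqVneq z 0; first by rewrite linearf0 // !normr0 mulr0.
  have nz : 0 < `|z| by rewrite normr_gt0.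
  rewrite -ler_pdivrMr //; apply: ub_le_sup; first exact: hA.2.
  exists (`|z|^-1 *: z); first by rewrite /= normrZ normfV normr_id mulVf // gt_eqF.
  by rewrite linearfZ // normrM normfV normr_id mulrC.
(* [f] has norm [sup A <= 1] and must be normalized to define a slice. It is nonzero since a good
   [d] exists near [- x1], at which the constraint is strict. *)
have s0 : 0 < sup A.
  have [||d gd _] := approx (- x1).
  - by rewrite normrN x1n.
  - have -> : x1 - - x1 = 2 *: x1 by rewrite opprK scaler_nat mulr2n.
    by rewrite normrZ x1n normr_nat; lra.
  rewrite ltNge; apply/negP => sA.
  have := fgood d gd; rewrite -linearfB //; have := fA (w d).
  have := ler_norm (f (w d)); rewrite /w.
  have : sup A * `|w d| <= 0 by rewrite mulr_le0_ge0.
  rewrite /w; lra.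
have sA1 : sup A <= 1.
  by apply: ge_sup hA.1 _ => _ [z z1 <-]; exact: le_trans (fle z) z1.
pose g z := (sup A)^-1 * f z.
have lg : linearf g by move=> a u v; rewrite /g lf; ring.
have gle z : `|g z| <= `|z|.
  by rewrite /g normrM normfV (gtr0_norm s0) ler_pdivrMl.
have gc : continuous g.
  move=> z; apply/cvgrPdist_lt => d d0; near=> z'.
  rewrite -linearfB //; apply: (le_lt_trans (gle _)); near: z'.
  exact: cvgr_dist_lt.
have gs : sup [set `|g y| | y in [set y : X | `|y| <= 1]] = 1.
  apply/eqP; rewrite eq_le; apply/andP; split.
    apply: ge_sup; first by exists `|g 0|, 0; rewrite //= normr0.
    by move=> _ [z z1 <-]; exact: le_trans (gle z) z1.
  rewrite -(ler_pM2l s0) mulr1; apply: ge_sup hA.1 _ => _ [z z1 <-].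
  rewrite -ler_pdivrMl //; apply: ub_le_sup; last first.
    by exists z => //; rewrite /g normrM normfV (gtr0_norm s0).
  by exists 1 => _ [z' z'1 <-]; exact: le_trans (gle z') z'1.
(* In this slice [f z > (1 - e) * sup A >= f y], while a good [d] within [2 * t < e] of [z]
   satisfies [f d <= f y - e]. *)
have [z [z1 [gz xz]]] := dX t x1 g e t0 x1n lg gc gs e0.
have [d gd zd] := approx z z1 xz.
have := fgood d gd.
have : (1 - e) * sup A < f z by move: gz; rewrite /g ltr_pdivlMl // mulrC.
have := fn (z - j (ratseq R d)); rewrite linearfB //.
have := le_trans (ler_norm _) (fA (j (ratseq R y))); rewrite jm.
have : sup A * mu y <= sup A * (1 - e) by rewrite ler_pM2l.
lra.
Unshelve. all: by end_near. Qed.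

End DaugavetCriterion.

(** * The criterion is a G_delta condition *)

Section CriterionGdelta.
Variable R : realType.

HB.instance Definition _ := gen_eqMixin V.

Lemma ptws_eval_continuous (v : V) : continuous (fun mu : {ptws V -> R} => mu v).
Proof. exact: (@proj_continuous V (fun=> R) v). Qed.

Lemma open_lt_fun (T : topologicalType) (f g : T -> R) :
  continuous f -> continuous g -> open [set t | f t < g t].
Proof.
move=> cf cg; rewrite (_ : [set t | _] = (fun t => g t - f t) @^-1` [set x | 0 < x]).
  apply: open_comp; last exact: open_gt.
  by move=> t _; apply: cvgB; [exact: cg|exact: cf].
by apply/seteqP; split=> t /=; rewrite subr_gt0.
Qed.

(** Every alternative consists of finitely many strict inequalities between continuous functions of
    [mu], up to a union over the lists [s]. *)
Lemma open_crit_at (T : topologicalType) (ev : T -> V -> R) (e : R) x y :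
  (forall v, continuous (ev^~ v)) -> open [set mu | crit_at e x y (ev mu)].
Proof.
move=> evc; have cst (c : R) : continuous (fun _ : T => c) by exact: cst_continuous.
have ogood d : open [set mu | good (ev mu) e x d].
  rewrite (_ : [set mu | _] = [set mu | ev mu d < 1] `&`
      [set mu | ev mu x + 1 - e < ev mu (vsub x d)]).
    apply: openI; apply: open_lt_fun => // mu.
    by apply: cvgB (cst e mu); apply: cvgD (evc x mu) (cst 1 mu).
  by apply/seteqP; split=> mu; rewrite /= /good => /andP.
have oall s : open [set mu | all (good (ev mu) e x) s].
  elim: s => [|d s IH].
    by rewrite (_ : [set mu | _] = setT); [exact: openT|apply/seteqP; split].
  rewrite (_ : [set mu | _] = [set mu | good (ev mu) e x d] `&`
      [set mu | all (good (ev mu) e x) s]); first exact: openI.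
  by apply/seteqP; split=> mu /= => /andP.
rewrite (_ : [set mu | _] = [set mu | ev mu x < e] `|`
    [set mu | 1 - e < ev mu y] `|`
    \bigcup_(s in [set s | (0 < size s)%N])
      ([set mu | all (good (ev mu) e x) s] `&`
       [set mu | ev mu (vdev y s) < (size s)%:R * e])).
  apply: openU; first by apply: openU; exact: open_lt_fun.
  by apply: bigcup_open => s _; apply: openI => //; exact: open_lt_fun.
apply/seteqP; split=> mu /=.
  by case=> [h|h|[s [s0 gs hs]]]; [left; left|left; right|right; exists s].
by case=> [[h|h]|[s s0 [gs hs]]]; [exact: Or31|exact: Or32|apply: Or33; exists s].
Qed.

Fact finsupp_nth (s : seq rat) : finsupp (nth 0 s).
Proof. by exists (size s) => n sn; rewrite nth_default. Qed.

(** A surjection onto [V] from a countable type, through which [crit] becomes a countable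
    intersection. *)
Definition V_of_seq (s : seq rat) : V := exist _ _ (finsupp_nth s).

Lemma V_of_seq_surj v : exists s, V_of_seq s = v.
Proof.
have [N vN] := svalP v; exists (mkseq (sval v) N); apply: V_inj.
apply/funext => n /=; have [nN|Nn] := ltnP n N; first by rewrite nth_mkseq.
by rewrite nth_default ?size_mkseq // vN.
Qed.

Lemma crit_Gdelta : Gdelta [set mu : {ptws V -> R} | crit mu].
Proof.
pose U (n : nat) := if unpickle n is Some (s, t, k)
  then [set mu : {ptws V -> R} | crit_at k.+1%:R^-1 (V_of_seq s) (V_of_seq t) mu]
  else setT.
exists U; split=> [n|].
  rewrite /U; case: unpickle => [[[s t] k]|]; last exact: openT.
  exact: (open_crit_at (ev := fun mu : {ptws V -> R} => mu) _ _ _ ptws_eval_continuous).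
apply/seteqP; split=> [mu cmu n _|mu cmu x y k].
  by rewrite /U; case: unpickle => [[[s t] k]|] //; exact: cmu.
have [[s <-] [t <-]] := (V_of_seq_surj x, V_of_seq_surj y).
by have := cmu (pickle (s, t, k)) I; rewrite /U pickleK.
Qed.

End CriterionGdelta.

(** * L1 norms on the dyadic tree *)

Section Tree.

(** The value on cell [k] of level [L] of the step function with coefficients [x]. The basis
    consists of the constant 1, of index 0, and the indicators of the cells [k] of level [L + 1]
    with [2 ^ L <= k < 2 ^ (L + 1)]. *)
Fixpoint cell_value (T : zmodType) (x : nat -> T) (L k : nat) : T :=
  if L is L'.+1 then
    if (k < 2 ^ L')%N then cell_value x L' k
    else x k + cell_value x L' (k - 2 ^ L')
  else x 0%N.

(** Coefficients of the step function with value [h k] on cell [k] of level [L]. One child keeps the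
    number of its parent, so the coefficient of the other is the difference between the two
    children. *)
Fixpoint cell_inv (T : zmodType) (h : nat -> T) (L k : nat) : T :=
  if L is L'.+1 then
    if (k < 2 ^ L')%N then cell_inv h L' k
    else if (k < 2 ^ L)%N then h k - h (k - 2 ^ L')%N else 0
  else if k == 0%N then h 0%N else 0.

Lemma ltn_sub_pow L k : (k < 2 ^ L.+1)%N -> (2 ^ L <= k)%N -> (k - 2 ^ L < 2 ^ L)%N.
Proof. by move=> kL Lk; rewrite ltn_subLR // addnn -mul2n -expnS. Qed.

Lemma ltn_pow_trans L k : (k < 2 ^ L)%N -> (k < 2 ^ L.+1)%N.
Proof. by move=> /leq_trans; apply; rewrite leq_exp2l. Qed.

Section Zmod.
Variable T : zmodType.
Implicit Types x y h : nat -> T.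

Lemma cell_value0 x L : cell_value x L 0 = x 0%N.
Proof. by elim: L => //= L IH; rewrite expn_gt0. Qed.

Lemma cell_value_zero L k : cell_value (fun=> 0 : T) L k = 0.
Proof. by elim: L k => //= L IH k; case: ifP => _; rewrite ?add0r. Qed.

Lemma cell_value_ext x y L k : (forall i, (i < 2 ^ L)%N -> x i = y i) ->
  (k < 2 ^ L)%N -> cell_value x L k = cell_value y L k.
Proof.
elim: L k => [|L IH] k xy kL /=; first exact: xy.
have xy' i : (i < 2 ^ L)%N -> x i = y i by move=> /ltn_pow_trans; exact: xy.
case: ltnP => [|Lk]; first exact: IH.
by rewrite xy // IH // ltn_sub_pow.
Qed.

Lemma cell_inv_supp h L k : (2 ^ L <= k)%N -> cell_inv h L k = 0.
Proof.
case: L => [|L] /= Lk; first by case: k Lk.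
have Lk' : (2 ^ L <= k)%N by apply: leq_trans Lk; rewrite leq_exp2l.
by rewrite ltnNge Lk' /= ltnNge Lk.
Qed.

Lemma cell_inv_finsupp h L : finsupp (cell_inv h L).
Proof. by exists (2 ^ L)%N => k; exact: cell_inv_supp. Qed.

Lemma cell_invK h L k : (k < 2 ^ L)%N -> cell_value (cell_inv h L) L k = h k.
Proof.
elim: L k => [|L IH] k kL /=; first by case: k kL.
have ext i : (i < 2 ^ L)%N -> cell_value (cell_inv h L.+1) L i = h i.
  by move=> iL; rewrite -[RHS](IH i iL); apply: cell_value_ext => // l lL /=; rewrite lL.
case: ltnP => [|Lk]; first exact: ext.
by rewrite kL ext ?subrK // ltn_sub_pow.
Qed.

Lemma cell_value_inj x L : (forall k, (k < 2 ^ L)%N -> cell_value x L k = 0) ->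
  forall k, (k < 2 ^ L)%N -> x k = 0.
Proof.
elim: L => [|L IH] x0 k kL; first by case: k kL => // _; exact: (x0 0%N).
have x0' i : (i < 2 ^ L)%N -> cell_value x L i = 0.
  by move=> iL; have := x0 i (ltn_pow_trans iL); rewrite /= iL.
have [kL'|Lk] := ltnP k (2 ^ L); first exact: IH.
have := x0 k kL; rewrite /= ltnNge Lk /= x0' ?addr0 //.
exact: ltn_sub_pow.
Qed.

End Zmod.

Lemma cell_value_lin (T : pzRingType) (a : T) (x y : nat -> T) L k :
  cell_value (fun n => a * x n + y n) L k = a * cell_value x L k + cell_value y L k.
Proof.
elim: L k => //= L IH k; case: ifP => // _.
by rewrite IH mulrDr addrACA.
Qed.

Lemma sum_pow2S (T : nmodType) (F : nat -> T) L :
  \sum_(k < 2 ^ L.+1) F k = \sum_(k < 2 ^ L) (F k + F (k + 2 ^ L)%N).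
Proof.
rewrite -(big_mkord xpredT F) -(big_mkord xpredT (fun k => F k + F (k + 2 ^ L)%N)).
rewrite expnS mul2n -addnn (@big_cat_nat _ _ _ (2 ^ L)) ?leq_addr //=.
by rewrite -{2}[(2 ^ L)%N]add0n big_addn addnK big_split.
Qed.

Variable R : realType.
Implicit Types (r : nat -> R) (x y : nat -> R).

(* Dyadic cells of level L are numbered by k < 2 ^ L, the children of cell k
   being k and k + 2 ^ L. The cells containing the special point are those
   with k = 0, of mass r L; all other cells are halved. *)
Fixpoint cell_mass r (L k : nat) : R :=
  if L is L'.+1 then
    if (k < 2 ^ L')%N then
      if k == 0%N then r L else cell_mass r L' k / 2
    else if k == (2 ^ L')%N then r L' - r L else cell_mass r L' (k - 2 ^ L') / 2
  else r 0%N.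

Definition level_norm r L x := \sum_(k < 2 ^ L) cell_mass r L k * `|cell_value x L k|.

Definition supp_level x : set nat := [set L | forall k, (2 ^ L <= k)%N -> x k = 0].

(** All levels that contain the support of [x] give the same value, so the choice made by [xget] is
    immaterial; its default is reached only outside c00. *)
Definition tree_norm r x := level_norm r (xget 0%N (supp_level x)) x.

Lemma c00_supp_level x : c00 x -> exists L, supp_level x L.
Proof.
move=> [N xN]; exists N => k Nk; apply: xN; apply: leq_trans Nk.
exact/ltnW/ltn_expl.
Qed.

Lemma supp_level_le x L L' : (L <= L')%N -> supp_level x L -> supp_level x L'.
Proof. by move=> LL xL k L'k; apply: xL; apply: leq_trans L'k; rewrite leq_exp2l. Qed.

Lemma c00_supp_level2 x y : c00 x -> c00 y -> exists L, supp_level x L /\ supp_level y L.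
Proof.
move=> /c00_supp_level[M xM] /c00_supp_level[N yN]; exists (maxn M N).
by split; [exact: supp_level_le (leq_maxl _ _) xM|exact: supp_level_le (leq_maxr _ _) yN].
Qed.

Lemma cell_mass0 r L : cell_mass r L 0 = r L.
Proof. by case: L => //= L; rewrite expn_gt0. Qed.

Lemma cell_mass_split r L k : (k < 2 ^ L)%N ->
  cell_mass r L.+1 k + cell_mass r L.+1 (k + 2 ^ L) = cell_mass r L k.
Proof.
move=> kL /=; rewrite kL ltnNge leq_addl /= addnK -{2}[(2 ^ L)%N]add0n eqn_add2r.
case: eqP => [->|_]; last by rewrite -splitr.
by rewrite cell_mass0 addrC subrK.
Qed.

(** Past the support of [x] the two children of a cell carry the value of their parent, and their
    masses add up to its mass. *)
Lemma level_normS r x L : supp_level x L -> level_norm r L.+1 x = level_norm r L x.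
Proof.
move=> xL; rewrite /level_norm (sum_pow2S (fun k => cell_mass r L.+1 k * `|cell_value x L.+1 k|)).
apply: eq_bigr => k _; rewrite -(cell_mass_split r (ltn_ord k)) mulrDl; congr (_ * _ + _ * _).
  by rewrite /= ltn_ord.
by rewrite /= ltnNge leq_addl /= addnK xL ?leq_addl // add0r.
Qed.

Lemma level_norm_stable r x L L' : (L <= L')%N -> supp_level x L ->
  level_norm r L' x = level_norm r L x.
Proof.
move=> + xL; elim: L' => [|L' IH]; first by rewrite leqn0 => /eqP ->.
rewrite leq_eqVlt => /orP[/eqP<-//|]; rewrite ltnS => LL'.
by rewrite level_normS ?IH //; exact: supp_level_le xL.
Qed.

Lemma tree_normE r x L : supp_level x L -> tree_norm r x = level_norm r L x.
Proof.
move=> xL; have /xgetPex : exists L, supp_level x L by exists L.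
move=> /(_ 0%N); rewrite /tree_norm; set L' := xget _ _ => xL'.
rewrite -(level_norm_stable r (leq_maxl L L') xL).
by rewrite (level_norm_stable r (leq_maxr L L') xL').
Qed.

Lemma supp_level_lin a x y L : supp_level x L -> supp_level y L ->
  supp_level (fun n => a * x n + y n) L.
Proof. by move=> xL yL k Lk; rewrite xL // yL // mulr0 addr0. Qed.

Section Masses.
Variable r : nat -> R.
Hypotheses (r0 : forall n, 0 <= r n) (rS : forall n, r n.+1 <= r n).

Lemma weight_le m n : (m <= n)%N -> r n <= r m.
Proof.
elim: n => [|n IH]; first by rewrite leqn0 => /eqP ->.
rewrite leq_eqVlt => /orP[/eqP->//|]; rewrite ltnS => /IH.
exact: le_trans.
Qed.

Lemma cell_mass_ge0 L k : 0 <= cell_mass r L k.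
Proof.
elim: L k => //= L IH k.
by do 2 case: ifP => _ //; rewrite ?divr_ge0 // subr_ge0.
Qed.

Lemma cell_mass_le L k : cell_mass r L k <= r 0%N.
Proof.
elim: L k => //= L IH k.
have half i : cell_mass r L i / 2 <= r 0%N by have := IH i; have := r0 0; lra.
case: ifP => _; case: ifP => _ //; first exact: weight_le.
by have := @weight_le 0 L (leq0n _); have := r0 L.+1; lra.
Qed.

(** Either the cell contains the special point or left its branch after level [j], with mass at most
    [r j], or it has been halved at each of the last [i] levels. *)
Lemma cell_mass_bound j i k :
  cell_mass r (j + i) k <= Num.max (r j) (r 0%N / 2 ^+ i).
Proof.
elim: i k => [|i IH] k; first by rewrite addn0 expr0 divr1 le_max cell_mass_le orbT.
have half l : cell_mass r (j + i) l / 2 <= Num.max (r j) (r 0%N / 2 ^+ i.+1).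
  have := IH l; rewrite !le_max exprS invfM mulrCA [2^-1 * _]mulrC.
  case/orP => h; last by rewrite ler_pM2r // h orbT.
  by have -> : cell_mass r (j + i) l / 2 <= r j by have := r0 j; lra.
rewrite addnS /=; case: ifP => _; case: ifP => _ //.
  by rewrite le_max (@weight_le j (j + i).+1) // ltnW // ltnS leq_addr.
rewrite le_max; apply/orP; left.
by have := @weight_le j (j + i) (leq_addr _ _); have := r0 (j + i).+1; lra.
Qed.

Lemma cell_mass_small e : (forall d, 0 < d -> exists K, r K < d) -> 0 < e ->
  exists L0, forall L k, (L0 <= L)%N -> cell_mass r L k < e.
Proof.
move=> rlim e0; have [j je] := rlim e e0.
have [i ie] : exists i : nat, r 0%N / e < i%:R.
  by exists (Num.truncn (r 0%N / e)).+1; rewrite truncnS_gt.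
exists (j + i)%N => L k jL; rewrite -(subnKC jL) -addnA.
apply: le_lt_trans (cell_mass_bound _ _ _) _; rewrite gt_max je /=.
rewrite ltr_pdivrMr ?exprn_gt0 // mulrC -ltr_pdivrMr //.
apply: (lt_le_trans ie); rewrite -natrX ler_nat.
by apply: (leq_trans (leq_addr (L - (j + i)) i)); exact/ltnW/ltn_expl.
Qed.

Lemma tree_norm_seminorm : seminorm_c00 (tree_norm r).
Proof.
split=> [x y cx cy|a x cx].
  have [L [xL yL]] := c00_supp_level2 cx cy.
  have xyL := supp_level_lin 1 xL yL.
  have -> : (fun n => x n + y n) = (fun n => 1 * x n + y n).
    by apply/funext => n; rewrite mul1r.
  rewrite !(tree_normE r (L := L)) // -big_split; apply: ler_sum => k _ /=.
  rewrite cell_value_lin mul1r -mulrDr; apply: ler_wpM2l; first exact: cell_mass_ge0.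
  exact: ler_normD.
have [L xL] := c00_supp_level cx.
have x0L := supp_level_lin a xL (fun k _ => erefl : (fun=> 0 : R) k = 0).
have -> : (fun n => a * x n) = (fun n => a * x n + (fun=> 0) n).
  by apply/funext => n; rewrite addr0.
rewrite !(tree_normE r (L := L)) // mulr_sumr; apply: eq_bigr => k _.
by rewrite cell_value_lin cell_value_zero addr0 normrM mulrCA.
Qed.

End Masses.

End Tree.

(** * Tree norms on c00 and the atomless case *)

Section TreeSpace.
Variables (R : realType) (r : nat -> R).
Hypotheses (r_gt0 : forall n, 0 < r n) (r_dec : forall n, r n.+1 < r n).

Let r_ge0 n : 0 <= r n := ltW (r_gt0 n).
Let r_ninc n : r n.+1 <= r n := ltW (r_dec n).

Definition tree_mu (s : nat -> R) (v : V) : R := tree_norm s (ratseq R v).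

Lemma sum_c00 (K : nat) (a : nat -> R) (F : nat -> nat -> R) : (forall i, c00 (F i)) ->
  c00 (fun n => \sum_(i < K) a i * F i n).
Proof.
move=> cF; elim: K => [|K IH].
  have := finsupp0 R; rewrite /c00 /=; congr finsupp.
  by apply/funext => n; rewrite big_ord0.
have := finsupp_lin (a K) (cF K) IH; rewrite /c00 /=; congr finsupp.
by apply/funext => n; rewrite big_ord_recr /= addrC.
Qed.

Lemma linear_sum_c00 (W : lmodType R) (psi : (nat -> R) -> W) (K : nat)
    (a : nat -> R) (F : nat -> nat -> R) :
  (forall b x y, c00 x -> c00 y -> psi (fun n => b * x n + y n) = b *: psi x + psi y) ->
  (forall i, c00 (F i)) ->
  psi (fun n => \sum_(i < K) a i * F i n) = \sum_(i < K) a i *: psi (F i).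
Proof.
move=> lpsi cF; elim: K => [|K IH].
  have := lpsi 1 _ _ (finsupp0 R) (finsupp0 R); rewrite scale1r big_ord0.
  have -> : (fun n : nat => 1 * (0 : R) + 0) = fun=> 0.
    by apply/funext => n; rewrite mul1r addr0.
  have -> : (fun n => \sum_(i < 0) a i * F i n) = fun=> 0.
    by apply/funext => n; rewrite big_ord0.
  by move/eqP; rewrite -subr_eq0 opprD addrA subrr add0r oppr_eq0 => /eqP.
rewrite big_ord_recr /= -IH addrC -lpsi //; last exact: sum_c00.
by congr psi; apply/funext => n; rewrite big_ord_recr /= addrC.
Qed.

Lemma tree_mubar : mubar_of (tree_mu r) (tree_norm r).
Proof. by split; first exact: tree_norm_seminorm. Qed.

Lemma tree_mu_seminorm : seminorm_V (tree_mu r).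
Proof.
have [sD sZ] := tree_norm_seminorm r_ge0 r_ninc.
split=> [u v w uvw|q u w uw].
  have -> : tree_mu r w = tree_norm r (fun n => ratseq R u n + ratseq R v n).
    by congr tree_norm; apply/funext => n; rewrite /ratseq uvw rmorphD.
  by apply: sD; exact: c00_ratseq.
rewrite ratr_norm -sZ; last exact: c00_ratseq.
by congr tree_norm; apply/funext => n; rewrite /ratseq uw rmorphM.
Qed.

Lemma cell_mass_gt0 L k : 0 < cell_mass r L k.
Proof.
elim: L k => //= L IH k.
by do 2 case: ifP => _ //; rewrite ?divr_gt0 // subr_gt0.
Qed.

Lemma tree_norm_eq0 x : c00 x -> tree_norm r x = 0 -> x = fun=> 0.
Proof.
move=> cx; have [L xL] := c00_supp_level cx; rewrite (tree_normE r xL) => /eqP.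
rewrite psumr_eq0 => [/allP x0|k _]; last by rewrite mulr_ge0 // ltW ?cell_mass_gt0.
apply/funext => k; have [kL|] := ltnP k (2 ^ L); last exact: xL.
apply: cell_value_inj kL => i iL; apply/eqP.
have := x0 (Ordinal iL) (mem_index_enum _).
by rewrite /= mulf_eq0 gt_eqF ?cell_mass_gt0 // normr_eq0.
Qed.

Lemma tree_mu_B : Bset (tree_mu r : {ptws V -> R}).
Proof.
have uniq m : mubar_of (tree_mu r) m -> forall x, c00 x -> m x = tree_norm r x.
  by move=> hm x cx; exact: (mubar_unique hm tree_mubar cx).
split; last by move=> m hm x cx; rewrite uniq //; exact: tree_norm_eq0.
split; first exact: tree_mu_seminorm.
move=> m hm X j [jl [jm _]] n; exists (fun i => j (unit_seq R i)) => c cj i.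
pose a k := if insub k is Some i then c i else 0.
have aE (l : 'I_n) : a l = c l by rewrite /a valK.
have := linear_sum_c00 n a jl (c00_unit R).
rewrite (eq_bigr (fun i : 'I_n => c i *: j (unit_seq R i))); last by move=> l _; rewrite aE.
rewrite cj; have cs := sum_c00 n a (c00_unit R).
move=> /eqP; rewrite -normr_eq0 jm // uniq // => /eqP /(tree_norm_eq0 cs).
move=> /(congr1 (fun f => f (val i))) /=; rewrite (bigD1 i) //= big1 => [|l li].
  by rewrite /unit_seq eqxx mulr1 addr0 aE.
by rewrite /unit_seq [val i == _]eq_sym (inj_eq val_inj) (negbTE li) mulr0.
Qed.

(** Coefficients of the indicator of cell [c] of level [L]. *)
Definition cell_unit (L c : nat) : nat -> R := cell_inv (fun k => (k == c)%:R) L.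

(** Both sides take the same values on the cells of level [L], and these determine the
    coefficients. *)
Lemma cell_expand (x : nat -> R) L n : supp_level x L ->
  x n = \sum_(c < 2 ^ L) cell_value x L c * cell_unit L c n.
Proof.
move=> xL; pose y n := \sum_(c < 2 ^ L) cell_value x L c * cell_unit L c n.
have yL : supp_level y L.
  by move=> k Lk; rewrite /y big1 // => c _; rewrite /cell_unit cell_inv_supp // mulr0.
have [nL|Ln] := ltnP n (2 ^ L); last by rewrite xL // -[RHS]/(y n) yL.
apply/eqP; rewrite -subr_eq0 -[_ - _]/(x n - y n).
have := @cell_value_inj _ (fun n => -1 * y n + x n) L _ n nL.
rewrite mulN1r addrC => -> // k kL; rewrite cell_value_lin.
have -> : cell_value y L k = \sum_(c < 2 ^ L) cell_value x L c * cell_value (cell_unit L c) L k.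
  apply: (@linear_sum_c00 R^o (fun z => cell_value z L k) (2 ^ L) (cell_value x L) (cell_unit L)).
    by move=> b u v _ _; exact: cell_value_lin.
  by move=> i; exact: cell_inv_finsupp.
rewrite (bigD1 (Ordinal kL)) //= big1 => [|c ck].
  by rewrite cell_invK // eqxx mulr1 addr0 mulN1r addNr.
rewrite cell_invK // (_ : (k == c) = false) ?mulr0 //.
by apply/negbTE; apply: contra ck => /eqP kc; apply/eqP/val_inj.
Qed.

(** Refinement past the support creates no new values, so [C] serves all fine levels, where the
    cells may then be made small. *)
Lemma cell_value_bounded (x : nat -> R) : c00 x ->
  exists C L0, supp_level x L0 /\ forall L k, (L0 <= L)%N -> `|cell_value x L k| <= C.
Proof.
move=> cx; have [L0 xL0] := c00_supp_level cx.
pose B := \sum_(i < 2 ^ L0) `|x i|.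
have B0 : 0 <= B by apply: sumr_ge0.
have xB k : `|x k| <= B.
  have [kL|/xL0 ->] := ltnP k (2 ^ L0); last by rewrite normr0.
  by rewrite /B (bigD1 (Ordinal kL)) //= lerDl sumr_ge0.
have bL L k : `|cell_value x L k| <= L.+1%:R * B.
  elim: L k => [|L IH] k /=; first by rewrite mul1r.
  case: ifP => _; first by apply: (le_trans (IH k)); apply: ler_wpM2r; rewrite // ler_nat.
  by apply: (le_trans (ler_normD _ _)); rewrite -natr1 mulrDl mul1r addrC lerD.
exists (L0.+1%:R * B), L0; split=> // L k.
elim: L k => [|L IH] k; first by rewrite leqn0 => /eqP L00; rewrite -L00 in bL *; exact: bL.
rewrite leq_eqVlt => /orP[/eqP <-//|]; rewrite ltnS => L0L /=.
case: ltnP => Lk; first exact: IH.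
rewrite xL0 ?add0r; first exact: IH.
by apply: leq_trans Lk; rewrite leq_exp2l.
Qed.

(** Only cell [c] is affected. The norm is additive up to cancellation there, at most twice the
    contribution of [x] on that cell. *)
Lemma tree_norm_unit_dist (x : nat -> R) L c (s : R) :
  supp_level x L -> (c < 2 ^ L)%N -> `|s| = 1 ->
  tree_norm r x + 1 - 2 * (cell_mass r L c * `|cell_value x L c|) <=
  tree_norm r (fun n => x n - s / cell_mass r L c * cell_unit L c n).
Proof.
move=> xL cL s1; set M := cell_mass r L c.
have M0 : 0 < M by exact: cell_mass_gt0.
have uL : supp_level (cell_unit L c) L by move=> k; exact: cell_inv_supp.
have -> : (fun n => x n - s / M * cell_unit L c n) =
    (fun n => - (s / M) * cell_unit L c n + x n).
  by apply/funext => n; rewrite mulNr addrC.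
rewrite (tree_normE r xL) (tree_normE r (supp_level_lin _ uL xL)).
rewrite /level_norm (bigD1 (Ordinal cL)) //= [leRHS](bigD1 (Ordinal cL)) //=.
rewrite cell_value_lin cell_invK // eqxx mulr1 -/M.
rewrite [X in _ <= _ + X](eq_bigr (fun k : 'I_(2 ^ L) => cell_mass r L k * `|cell_value x L k|)) => [|k kc].
  have : M * (`|s / M| - `|cell_value x L c|) <= M * `|- (s / M) + cell_value x L c|.
    by rewrite ler_pM2l // [X in _ <= `|X|]addrC distrC lerB_dist.
  rewrite mulrBr normrM s1 mul1r normfV (gtr0_norm M0) mulfV ?gt_eqF //; lra.
rewrite cell_value_lin cell_invK // (_ : (val k == c) = false) ?mulr0 ?add0r //.
by apply/negbTE; apply: contra kc => /eqP kc; apply/eqP/val_inj.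
Qed.

Lemma tree_norm_unit L c (a : R) : (c < 2 ^ L)%N ->
  tree_norm r (fun n => a * cell_unit L c n) = `|a| * cell_mass r L c.
Proof.
move=> cL; rewrite (tree_norm_seminorm r_ge0 r_ninc).2; last exact: cell_inv_finsupp.
congr (_ * _); rewrite (tree_normE r (L := L)); last by move=> k; exact: cell_inv_supp.
rewrite /level_norm (bigD1 (Ordinal cL)) //= cell_invK // eqxx normr1 mulr1 big1 ?addr0 //.
move=> k kc; rewrite cell_invK // (_ : (val k == c) = false) ?normr0 ?mulr0 //.
by apply/negbTE; apply: contra kc => /eqP kc; apply/eqP/val_inj.
Qed.

(* A functional on step functions is controlled by its values on normalized
   indicators of cells, and atomless means that these become almost disjoint
   from any given x. *)
Theorem tree_daugavet : (forall d, 0 < d -> exists K, r K < d) ->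
  Xmu_daugavet (tree_mu r).
Proof.
move=> rlim m hm X j cj; have [sm me] := hm.
have mE x : c00 x -> m x = tree_norm r x.
  by move=> cx; exact: (mubar_unique hm tree_mubar cx).
apply: (daugavet_slice sm cj) => u v f e lf fle e0 ex v1.
set x := ratseq R u; set y := ratseq R v in v1 *.
have cx : c00 x by exact: c00_ratseq.
have cy : c00 y by exact: c00_ratseq.
have [C [Lx [xL xC]]] := cell_value_bounded cx.
have [Ly yL] := c00_supp_level cy.
have C1 : 0 < 2 * (`|C| + 1) by rewrite mulr_gt0 // ltr_wpDl.
(* With this bound every cell contributes less than [e / 2] to the norm of [x]. *)
have [L0 small] := cell_mass_small r_ge0 r_ninc rlim (divr_gt0 e0 C1).
pose L := maxn Lx (maxn Ly L0).
have {}xL : supp_level x L by apply: supp_level_le xL; exact: leq_maxl.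
have {}yL : supp_level y L by apply: supp_level_le yL; rewrite !leq_max leqnn orbT.
have {}small k : cell_mass r L k < e / (2 * (`|C| + 1)).
  by apply: small; rewrite !leq_max leqnn !orbT.
have {}xC k : `|cell_value x L k| <= C by apply: xC; exact: leq_maxl.
have cu c : c00 (cell_unit L c) by exact: cell_inv_finsupp.
have jZ a c : j (fun n => a * cell_unit L c n) = a *: j (cell_unit L c).
  rewrite -[RHS]addr0 -(compl_zero sm cj) -cj.1 //; last exact: finsupp0.
  by congr j; apply/funext => n; rewrite addr0.
(* Otherwise [|f|] is at most [tau = f y - e] on all normalized indicators, and expanding [y] gives
   [f y <= tau * m y <= tau]. *)
have [c [s [cL s1 hf]]] : exists c s, [/\ (c < 2 ^ L)%N, `|s| = 1 &
    f (j y) - e < f (j (fun n => s / cell_mass r L c * cell_unit L c n))].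
  apply: contrapT => no; set tau := f (j y) - e.
  have le c : (c < 2 ^ L)%N -> `|f (j (cell_unit L c))| <= cell_mass r L c * tau.
    move=> cL; have M0 := cell_mass_gt0 L c.
    have les s : `|s| = 1 -> s * f (j (cell_unit L c)) <= cell_mass r L c * tau.
      move=> s1; rewrite leNgt; apply/negP => lt; apply: no; exists c, s; split=> //.
      by rewrite jZ linearfZ // mulrAC ltr_pdivlMr // mulrC.
    have := les 1 (normr1 _); have := les (-1) (normrN1 _).
    by rewrite ler_norml; lra.
  have tau0 : 0 <= tau.
    have L0' : (0 < 2 ^ L)%N by rewrite expn_gt0.
    have := le 0%N L0' => /(le_trans (normr_ge0 _)).
    by rewrite pmulr_rge0 // cell_mass_gt0.
  have : f (j y) <= tau * m y.
    rewrite (mE _ cy) (tree_normE r yL) /level_norm mulr_sumr.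
    have -> : f (j y) = \sum_(c < 2 ^ L) cell_value y L c * f (j (cell_unit L c)).
      transitivity (f (j (fun n => \sum_(c < 2 ^ L) cell_value y L c * cell_unit L c n))).
        by congr (f (j _)); apply/funext => n; exact: cell_expand.
      apply: (@linear_sum_c00 R^o (fun z => f (j z))) => // b z w cz cw.
      by rewrite cj.1 // lf.
    apply: ler_sum => c _; apply: le_trans (ler_norm _) _.
    rewrite normrM mulrC mulrA (mulrC tau); apply: ler_wpM2r => //.
    exact: le.
  have : tau * m y <= tau * 1 by apply: ler_wpM2l => //; exact: ltW.
  by rewrite /tau; lra.
exists (fun n => s / cell_mass r L c * cell_unit L c n); split=> //.
- exact: c00Z.
- rewrite mE; last exact: c00Z.
  rewrite tree_norm_unit // normrM s1 mul1r normfV gtr0_norm ?cell_mass_gt0 //.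
  by rewrite mulVf // gt_eqF // cell_mass_gt0.
- rewrite !mE //; last by apply: c00B => //; exact: c00Z.
  apply: lt_le_trans (tree_norm_unit_dist xL cL s1).
  have : cell_mass r L c * `|cell_value x L c| < e / 2.
    apply: (@le_lt_trans _ _ (cell_mass r L c * (`|C| + 1))).
      apply: ler_wpM2l; first exact/ltW/cell_mass_gt0.
      by apply: (le_trans (xC c)); have := ler_norm C; lra.
    rewrite -ltr_pdivlMr ?ltr_wpDl //; have := small c.
    by rewrite invfM mulrA.
  lra.
Qed.

End TreeSpace.

(** * The atomic case *)

Section TreeAtom.
Variables (R : realType) (r : nat -> R).
Hypotheses (r_gt0 : forall n, 0 < r n) (r_dec : forall n, r n.+1 < r n).

(** Lowering [r] by [rho] removes a point mass at the special point: the other masses come from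
    differences of successive values of [r], which do not change. *)
Lemma cell_mass_shift (rho : R) L k : (k < 2 ^ L)%N ->
  cell_mass r L k = cell_mass (fun n => r n - rho) L k + rho * (k == 0%N)%:R.
Proof.
elim: L k => [|L IH] k kL /=; first by case: k kL => // _; rewrite mulr1 subrK.
case: ltnP => kL'.
  case: eqP => k0; first by rewrite mulr1 subrK.
  by rewrite IH // (introF eqP k0) mulr0 !addr0.
have k0 : (k == 0%N) = false by rewrite gtn_eqF // (leq_trans _ kL') // expn_gt0.
rewrite k0 mulr0 addr0; case: eqP => k2; first by ring.
rewrite IH ?ltn_sub_pow // (_ : (k - 2 ^ L == 0)%N = false) ?mulr0 ?addr0 //.
by apply/negbTE; rewrite subn_eq0 -ltnNge ltn_neqAle kL' andbT eq_sym; apply/eqP.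
Qed.

(** The coefficient [x 0] is the value of the step function at the special point. *)
Lemma tree_norm_shift (rho : R) x : c00 x ->
  tree_norm r x = tree_norm (fun n => r n - rho) x + rho * `|x 0%N|.
Proof.
move=> /c00_supp_level[L xL]; rewrite !(tree_normE _ xL) /level_norm.
have L0 : (0 < 2 ^ L)%N by rewrite expn_gt0.
have -> : rho * `|x 0%N| = \sum_(k < 2 ^ L) rho * (val k == 0%N)%:R * `|cell_value x L k|.
  rewrite (bigD1 (Ordinal L0)) //= mulr1 cell_value0 big1 ?addr0 // => k k0.
  by rewrite (_ : (val k == 0%N) = false) ?mulr0 ?mul0r //; apply: negbTE.
by rewrite -big_split; apply: eq_bigr => k _; rewrite (cell_mass_shift rho) // mulrDl.
Qed.

Lemma ratr_cell_inv (h : nat -> rat) L k :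
  ratr (cell_inv h L k) = cell_inv (fun n => ratr (h n) : R) L k.
Proof.
by elim: L k => [|L IH] k /=; do ?case: ifP => _; rewrite ?rmorph0 ?rmorphB.
Qed.

(* If the special point is an atom of mass rho, then rho * |x 0| splits off as
   an L1-summand, so no d with d 0 bounded away from 0 is almost at distance
   |x| + 1 from the indicator x of a small cell around the atom. *)
Theorem tree_not_daugavet (rho0 : R) : 0 < rho0 -> (forall n, rho0 <= r n) ->
  ~ Xmu_daugavet (tree_mu r).
Proof.
move=> rho00 rho0r.
have lb : has_lbound (range r) by exists rho0 => _ [n _ <-].
have ne : range r !=set0 by exists (r 0%N), 0%N.
pose rho := inf (range r).
have rho_gt0 : 0 < rho.
  by apply: lt_le_trans rho00 _; apply: lb_le_inf => // _ [n _ <-].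
have rhor n : rho <= r n by apply: ge_inf => //; exists n.
(* At this level more than two thirds of the mass of the cell around the atom sits in the atom. *)
have [K rK] : exists K, r K < rho + rho / 2.
  have [|_ [K _ <-] rK] := @inf_adherent _ (range r) (rho / 2) _ (conj ne lb).
    by rewrite divr_gt0.
  by exists K.
have sN := tree_norm_seminorm (fun n => ltW (r_gt0 n)) (fun n => ltW (r_dec n)).
have sN' : seminorm_c00 (tree_norm (fun n => r n - rho)).
  by apply: tree_norm_seminorm => n; [rewrite subr_ge0|rewrite lerD2r ltW].
move=> /(daugavet_crit (tree_mu_seminorm r_gt0 r_dec)) cr.
pose x : V := exist _ _ (cell_inv_finsupp (fun k => (k == 0%N)%:R : rat) K).
have K0 : (0 < 2 ^ K)%N by rewrite expn_gt0.
have xE : ratseq R x = cell_unit R K 0.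
  apply/funext => n; rewrite /ratseq /= ratr_cell_inv; congr cell_inv.
  by apply/funext => k; rewrite ratr_nat.
have x0 : ratseq R x 0%N = 1.
  by rewrite xE -(cell_value0 _ K) cell_invK.
have mx : tree_mu r x = r K.
  have := tree_norm_unit r_gt0 r_dec 1 K0; rewrite normr1 mul1r cell_mass0 => <-.
  by congr tree_norm; apply/funext => n; rewrite xE mul1r.
have rK0 := r_gt0 K.
(* The vector [y = q x] then has norm below 1/2, while its part [rho * y 0] on the atom exceeds
   1/4. *)
have [|q] := @rat_in_itvoo R (1 / (4 * rho)) (1 / (2 * r K)).
  by rewrite !div1r ltf_pV2 ?posrE ?mulr_gt0 //; lra.
rewrite in_itv /= => /andP[q1 q2].
have q0 : 0 < ratr q :> R by apply: lt_trans q1; rewrite divr_gt0 // mulr_gt0.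
move: q1 q2; rewrite ltr_pdivrMr ?mulr_gt0 // ltr_pdivlMr ?mulr_gt0 // => q1 q2.
pose y := vlin q x vzero.
have yE n : ratseq R y n = ratr q * ratseq R x n by rewrite ratseq_lin ratseq0 addr0.
have my : tree_mu r y = ratr q * r K.
  rewrite -mx -{1}(gtr0_norm q0) /tree_mu -sN.2; last exact: c00_ratseq.
  by congr tree_norm; apply/funext.
have [|k] := @exists_inv_nat R (Num.min rho (1 / 6)).
  by rewrite lt_min rho_gt0 divr_gt0.
have := cr x y k; have : 0 < k.+1%:R^-1 :> R by rewrite invr_gt0 ltr0n.
move: (k.+1%:R^-1) => e e0; rewrite lt_min => + /andP[e_rho e6].
case; rewrite ?mx ?my; first by have := rhor K; lra.
  by lra.
move=> [s [s0 gs ms]].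
(* The atom alone loses [rho * (1 + |d 0| - |1 - d 0|)], which must be less than [e]. This is
   [2 * rho * d 0] for [d 0] in [0, 1], and [d 0 > 1] would give [2 * rho < e], against
   [e < rho]. *)
have hgood d : good (tree_mu r) e x d -> rho * ratseq R d 0%N <= e / 2.
  move=> /andP[d1]; rewrite mx /tree_mu ratseq_sub.
  have cx := c00_ratseq R x; have cd := c00_ratseq R d.
  rewrite (tree_norm_shift rho (c00B cx cd)) x0.
  have := semi_subl sN' cx cd.
  move: d1 mx; rewrite /tree_mu (tree_norm_shift rho cx) (tree_norm_shift rho cd) x0 normr1.
  move: (ratseq R d 0%N) => d0.
  have [h0|h0] := leP 0 d0; last first.
    have : rho * d0 < 0 by rewrite pmulr_rlt0.
    lra.
  have [h1|h1] := leP d0 1.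
    by rewrite (ger0_norm h0) ger0_norm ?subr_ge0 // mulrBr; lra.
  by rewrite (ger0_norm h0) ltr0_norm ?subr_lt0 // opprB mulrBr; lra.
(* Each term contributes at least [1/4 - e / 2] on the atom, which exceeds [e] because [e < 1/6]. *)
have : (size s)%:R * (4^-1 - e / 2) <= rho * ratseq R (vdev y s) 0%N.
  elim: s {s0 ms} gs => [|d s IH] /=; first by rewrite ratseq0 mul0r mulr0.
  move=> /andP[/hgood gd /IH {}IH].
  rewrite ratseq_lin rmorph1 mul1r ratseq_sub -[(size s).+1%:R]natr1.
  rewrite mulrDl mul1r [leLHS]addrC [leRHS]mulrDr lerD //.
  by rewrite yE x0 mulrBr; lra.
have := c00_ratseq R (vdev y s) => cv.
have := semi_c00_ge0 sN' cv; have := tree_norm_shift rho cv.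
have : rho * ratseq R (vdev y s) 0%N <= rho * `|ratseq R (vdev y s) 0%N|.
  by rewrite ler_pM2l // ler_norm.
move: ms; rewrite /tree_mu => ms.
have : (size s)%:R * e < (size s)%:R * (4^-1 - e / 2).
  by rewrite ltr_pM2l ?ltr0n //; lra.
lra.
Qed.

End TreeAtom.

(** * Reduction of G_delta sets *)

Section Reduction.
Variable R : realType.

Lemma ptws_continuous (Z : topologicalType) (f : Z -> {ptws V -> R}) :
  (forall v, continuous (fun z => f z v)) -> continuous f.
Proof.
move=> fc z; apply/cvg_sup => v; apply/cvg_image.
  by apply/seteqP; split=> // c _; exists (fun=> c).
move=> W Wf; exists (@^~ v @^-1` W); first exact: fc.
by apply/seteqP; split=> [_ [? ? <-]//|c Wc]; exists (fun=> c).
Qed.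

Lemma continuous_sum_ord (Z : topologicalType) (F : nat -> Z -> R) n :
  (forall i, continuous (F i)) -> continuous (fun z => \sum_(i < n) F i z).
Proof.
move=> cF; elim: n => [|n IH] z.
  rewrite (_ : (fun z => _) = fun=> 0); first exact: cvg_cst.
  by apply/funext => ?; rewrite big_ord0.
rewrite (_ : (fun z => _) = fun z => \sum_(i < n) F i z + F n z).
  by apply: cvgD; [exact: IH|exact: cF].
by apply/funext => ?; rewrite big_ord_recr.
Qed.

(** For fixed [v] the level can be chosen independently of [z], which leaves a finite sum of
    continuous masses. *)
Lemma tree_mu_continuous (Z : topologicalType) (w : Z -> nat -> R) :
  (forall n, continuous (w ^~ n)) ->
  continuous (fun z => tree_mu (w z) : {ptws V -> R}).
Proof.
move=> cw; apply: ptws_continuous => v.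
have [L vL] := c00_supp_level (c00_ratseq R v).
rewrite (_ : (fun z => _) = fun z => level_norm (w z) L (ratseq R v)); last first.
  by apply/funext => z; exact: tree_normE.
apply: (continuous_sum_ord
  (F := fun k z => cell_mass (w z) L k * `|cell_value (ratseq R v) L k|)) => k z.
apply: cvgM; last exact: cvg_cst.
elim: L k {vL} => [|L IH] k /=; first exact: cw.
case: ifP => _; case: ifP => _.
- exact: cw.
- by apply: cvgM; [exact: IH|exact: cvg_cst].
- by apply: cvgB; exact: cw.
- by apply: cvgM; [exact: IH|exact: cvg_cst].
Qed.

Lemma sum_ord_ge (F : nat -> R) M K : (M <= K)%N -> (forall n, 0 <= F n) ->
  (forall n, (n < M)%N -> 1 <= F n) -> M%:R <= \sum_(n < K) F n.
Proof.
move=> MK F0 F1; rewrite -(subnKC MK) big_split_ord /=; apply: ler_wpDr.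
  by apply: sumr_ge0 => n _; exact: F0.
elim: M F1 {MK} => [|M IH] F1; first by rewrite big_ord0.
rewrite big_ord_recr /= -natr1 lerD ?F1 //.
by apply: IH => n nM; apply: F1; exact: ltnW.
Qed.

Lemma sum_ord_le (F : nat -> R) i K : (forall n, F n <= 1) ->
  (forall n, (i <= n)%N -> F n = 0) -> \sum_(n < K) F n <= i%:R.
Proof.
move=> F1 F0; apply: (@le_trans _ _ (minn K i)%:R); last by rewrite ler_nat geq_minr.
elim: K => [|K IH]; first by rewrite big_ord0 min0n.
rewrite big_ord_recr /=; have [Ki|iK] := ltnP K i.
  by move: IH; rewrite (minn_idPl Ki) (minn_idPl (ltnW Ki)) -natr1 => IH; rewrite lerD.
by move: IH; rewrite F0 // addr0 (minn_idPr iK) (minn_idPr (leqW iK)).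
Qed.

Section Weights.
Variables (Z : topologicalType) (d : Z -> Z -> R) (U : nat -> set Z).
Hypotheses (d0 : forall x y, d x y = 0 <-> x = y) (dC : forall x y, d x y = d y x)
  (dT : forall x y z, d x z <= d x y + d y z)
  (dO : forall A : set Z, open A <->
     forall x, A x -> exists e : R, 0 < e /\ [set y | d x y < e] `<=` A).
Hypothesis oU : forall n, open (U n).

Let d_ge0 x y : 0 <= d x y.
Proof. by have := dT x y x; rewrite (dC y x) (d0 x x).2 //; lra. Qed.

Let dists n z := [set t : R | t = 1 \/ exists i y, [/\ (i <= n)%N, ~ U i y & t = d z y] ].

(* The distance, truncated at 1, to the complement of U_0 n ... n U_n. *)
Definition escape n z := inf (dists n z).

Let lb n z : has_lbound (dists n z).
Proof. by exists 0 => _ [->|[i [y [_ _ ->]]]]. Qed.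

Let ne n z : dists n z !=set0.
Proof. by exists 1; left. Qed.

Lemma escape_ge0 n z : 0 <= escape n z.
Proof. by apply: lb_le_inf => // _ [->|[i [y [_ _ ->]]]]. Qed.

Lemma escape_out n i z : (i <= n)%N -> ~ U i z -> escape n z = 0.
Proof.
move=> ni Uz; apply/eqP; rewrite eq_le escape_ge0 andbT.
by apply: ge_inf => //; right; exists i, z; split=> //; rewrite (d0 z z).2.
Qed.

Lemma escape_in n z : (forall i, (i <= n)%N -> U i z) -> 0 < escape n z.
Proof.
move=> Uz; suff [e [e0 e1 eU]] : exists e : R, [/\ 0 < e, e <= 1 &
    forall i y, (i <= n)%N -> d z y < e -> U i y].
  apply: (lt_le_trans e0); apply: lb_le_inf => // _ [->//|[i [y [ni Uy ->]]]].
  by rewrite leNgt; apply/negP => /(eU _ _ ni).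
elim: n Uz => [|n IH] Uz.
  have [e [e0 eU]] := (dO (U 0%N)).1 (oU 0) z (Uz 0%N isT).
  exists (Num.min e 1); rewrite lt_min e0 ltr01 ge_min lexx orbT; split=> // i y.
  by rewrite leqn0 => /eqP ->; rewrite lt_min => /andP[? _]; exact: eU.
have [i ni|e [e0 e1 eU]] := IH; first by apply: Uz; exact: leqW.
have [e' [e'0 e'U]] := (dO (U n.+1)).1 (oU _) z (Uz _ (leqnn _)).
exists (Num.min e e'); rewrite lt_min e0 e'0 ge_min e1; split=> // i y.
rewrite lt_min leq_eqVlt => /orP[/eqP -> /andP[_]|]; first exact: e'U.
by rewrite ltnS => ni /andP[? _]; exact: eU ni _.
Qed.

Lemma escape_lipschitz n x y : escape n x <= escape n y + d x y.
Proof.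
rewrite -lerBlDr; apply: lb_le_inf => // _ [->|[i [z [ni Uz ->]]]].
  have : escape n x <= 1 by apply: ge_inf => //; left.
  by have := d_ge0 x y; lra.
have : escape n x <= d x z by apply: ge_inf => //; right; exists i, z.
by have := dT x y z; lra.
Qed.

Lemma escape_continuous n : continuous (escape n).
Proof.
move=> x; apply/cvgrPdist_lt => e e0.
have oB : open [set y | d x y < e].
  apply/dO => y /= xy; exists (e - d x y); split; first by rewrite subr_gt0.
  by move=> z /= yz; have := dT x y z; lra.
apply: filterS (open_nbhs_nbhs (conj oB _)) => [y /= xy|]; last by rewrite /= (d0 x x).2.
have := escape_lipschitz n x y; have := escape_lipschitz n y x.
by rewrite (dC y x) ltr_norml; lra.
Qed.

(* Increases in K to the number of n with z in U_0 n ... n U_n. *)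
Definition escape_sum z (K : nat) := \sum_(n < K) Num.min 1 (K%:R * escape n z).

(** Subtracting [K.+1%:R^-1] makes the weights strictly decreasing even where [escape_sum] is
    constant; the summand 2 keeps the denominator at least 1. *)
Definition weight z (K : nat) := (2 + escape_sum z K - K.+1%:R^-1)^-1.

Lemma escape_sum_ge0 z K : 0 <= escape_sum z K.
Proof. by apply: sumr_ge0 => n _; rewrite le_min ler01 mulr_ge0 // escape_ge0. Qed.

Lemma escape_sumS z K : escape_sum z K <= escape_sum z K.+1.
Proof.
rewrite /escape_sum big_ord_recr /=; apply: ler_wpDr.
  by rewrite le_min ler01 mulr_ge0 // escape_ge0.
apply: ler_sum => n _; rewrite le_min ge_min lexx /= ge_min; apply/orP; right.
by rewrite ler_wpM2r ?escape_ge0 // ler_nat.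
Qed.

Let inv_le1 K : K.+1%:R^-1 <= 1 :> R.
Proof. by rewrite invf_le1 ?ltr0n // ler1n. Qed.

Let den_gt0 z K : 0 < 2 + escape_sum z K - K.+1%:R^-1.
Proof. by move: (escape_sum_ge0 z K) (inv_le1 K); move: (K.+1%:R^-1) => t; lra. Qed.

Lemma weight_gt0 z K : 0 < weight z K.
Proof. by rewrite invr_gt0. Qed.

Lemma weight_dec z K : weight z K.+1 < weight z K.
Proof.
rewrite ltf_pV2 ?posrE //.
have : K.+2%:R^-1 < K.+1%:R^-1 :> R by rewrite ltf_pV2 ?posrE ?ltr0n // ltr_nat.
by move: (escape_sumS z K); move: (K.+2%:R^-1) (K.+1%:R^-1) => t t'; lra.
Qed.

Lemma weight_continuous K : continuous (weight ^~ K).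
Proof.
move=> z; apply: cvgV; first by rewrite gt_eqF.
apply: cvgB; last exact: cvg_cst.
apply: cvgD; first exact: cvg_cst.
apply: (continuous_sum_ord (F := fun n z => Num.min 1 (K%:R * escape n z))) => n x.
apply: (continuous_min (f := fun=> 1) (g := fun z => K%:R * escape n z)); first exact: cvg_cst.
by apply: cvgM; [exact: cvg_cst|exact: escape_continuous].
Qed.

Lemma weight_lim0 z : (\bigcap_n U n) z ->
  forall e, 0 < e -> exists K, weight z K < e.
Proof.
move=> Uz e e0; pose M := (Num.truncn e^-1).+1.
have esc n : 0 < escape n z by apply: escape_in => i _; exact: Uz.
(* For [K] large each of the first [M] summands of [escape_sum] is truncated at 1, so the sum is at
   least [M]. *)
have [K [MK Kesc]] : exists K, (M <= K)%N /\ forall n, (n < M)%N -> 1 <= K%:R * escape n z.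
  elim: M => [|M [K [MK IH]]]; first by exists 0%N.
  pose K' := maxn K.+1 (Num.truncn (escape M z)^-1).+1.
  exists K'; split=> [|n]; first by rewrite leq_max ltnS MK.
  rewrite ltnS leq_eqVlt => /orP[/eqP ->|nM].
    rewrite -ler_pdivrMr // div1r; apply/ltW/(lt_le_trans (truncnS_gt _)).
    by rewrite ler_nat leq_maxr.
  apply: (le_trans (IH n nM)); rewrite ler_wpM2r ?(ltW (esc n)) // ler_nat.
  by rewrite leq_max leqnSn.
exists K; rewrite invf_plt ?posrE //.
apply: (lt_le_trans (truncnS_gt _)); rewrite -/M.
have : M%:R <= escape_sum z K.
  apply: (sum_ord_ge (F := fun n => Num.min 1 (K%:R * escape n z)) MK) => n.
    by rewrite le_min ler01 mulr_ge0 // escape_ge0.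
  by move=> nM; rewrite le_min lexx Kesc.
by move: (inv_le1 K); move: (K.+1%:R^-1) => t; lra.
Qed.

(** If [z] is outside [U i], all summands of index at least [i] vanish and [escape_sum] is at most
    [i]. *)
Lemma weight_bounded z : ~ (\bigcap_n U n) z ->
  exists2 rho, 0 < rho & forall K, rho <= weight z K.
Proof.
move=> nUz; have [i Uiz] : exists i, ~ U i z.
  by apply: contrapT => H; apply: nUz => i _; apply: contrapT => Uiz; apply: H; exists i.
have Sle K : escape_sum z K <= i%:R.
  apply: (sum_ord_le (F := fun n => Num.min 1 (K%:R * escape n z))) => n.
    by rewrite ge_min lexx.
  by move=> ni; rewrite (escape_out ni Uiz) mulr0 min_r.
have i0 : 0 < 2 + i%:R :> R by rewrite ltr_wpDr.
exists (2 + i%:R)^-1 => [|K]; first by rewrite invr_gt0.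
rewrite lef_pV2 ?posrE //.
have : 0 < K.+1%:R^-1 :> R by rewrite invr_gt0 ltr0n.
by move: (Sle K); move: (K.+1%:R^-1) => t; lra.
Qed.

End Weights.

End Reduction.

Theorem theorem5p8 (R : realType) (I : set {ptws V -> R}) :
  I = @Pset R \/ I = @Pinf R \/ I = @Bset R ->
  Gdelta_complete_in I (I `&` [set mu | Xmu_daugavet mu]).
Proof.
move=> hI.
have IP mu : I mu -> seminorm_V mu.
  by case: hI => [->//|[->|->]] => [[]//|[[]//]].
(* The reduction takes values in the smallest of the three spaces, so a single map serves every
   choice of [I]. *)
have BI mu : Bset mu -> I mu.
  by case: hI => [->|[->|->]] // [] // [].
split.
  have [U [oU UE]] := crit_Gdelta R; exists U; split=> //.
  rewrite -UE; apply/seteqP; split=> mu [Imu h]; split=> //.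
    exact: daugavet_crit (IP _ Imu) h.
  exact: crit_daugavet.
move=> Z [_ [d [d0 dC dT dO _]]] _ B [U [oU ->]].
exists (fun z => tree_mu (weight d U z)); split.
- by apply: tree_mu_continuous => K; exact: weight_continuous.
- move=> z; apply/BI/tree_mu_B => K; [exact: weight_gt0|exact: weight_dec].
- apply/seteqP; split=> z.
    move=> Uz; split.
      by apply/BI/tree_mu_B => K; [exact: weight_gt0|exact: weight_dec].
    apply: tree_daugavet => [K|K|]; [exact: weight_gt0|exact: weight_dec|].
    exact: weight_lim0.
  move=> [_ dz]; apply: contrapT => /(weight_bounded d0 dC dT) [rho rho0 hr].
  apply: tree_not_daugavet rho0 hr dz => K; [exact: weight_gt0|exact: weight_dec].
Qed.
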